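(* Let $(K,v)$ be a valued field of characteristic $p>0$. If $(K,v)$ admits an Artin-Schreier extension with dependent defect, then it admits infinitely many distinct Artin-Schreier extensions with dependent defect.
   Context: Valuations are Krull valuations of arbitrary rank, written additively; $vK$ is the value group and $Kv$ the residue field of $(K,v)$. $(L|K,v)$ denotes a field extension $L|K$ with a valuation $v$ on $L$, $K$ being endowed with the restriction. The extension is immediate if the canonical embeddings $vK\to vL$ and $Kv\to Lv$ are onto. An Artin-Schreier extension of a field of characteristic $p>0$ is a Galois extension of degree $p$. A Galois defect extension of prime degree $p$ is an immediate Galois extension $\mathcal{E}=(L|K,v)$ of degree $p$ such that $v$ has a unique extension from $K$ to $L$. For such an extension the set \[ \Sigma_{\mathcal{E}}:=\left\{ v\left(\frac{\sigma f-f}{f}\right) \,\Big|\, f\in L^{\times},\ \sigma f\neq f\right\} \] does not depend on the choice of the generator $\sigma$ of $\mathrm{Gal}(L|K)$. The extension $\mathcal{E}$ has independent defect if $\Sigma_{\mathcal{E}}=\{\alpha\in vK\mid \alpha>H_{\mathcal{E}}\}$ for some proper convex subgroup $H_{\mathcal{E}}$ of $vK$ (where $\alpha>H_{\mathcal{E}}$ means $\alpha>\beta$ for all $\beta\in H_{\mathcal{E}}$); otherwise it has dependent defect. An Artin-Schreier extension ''with dependent defect'' is one that is a Galois defect extension of degree $p$ having dependent defect. *)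

(* Defs.v *)
From HB Require Import structures.
From mathcomp Require Import all_boot all_order all_algebra.
From mathcomp Require Import all_fingroup all_solvable all_field.
From mathcomp Require Import boolp classical_sets.

Set Implicit Arguments.
Unset Strict Implicit.
Unset Printing Implicit Defensive.

Import Order.TTheory GRing.Theory Num.Theory.

Local Open Scope classical_set_scope.
Local Open Scope ring_scope.

(* porderZmodType only joins a partial order and a group law: totality and      *)
(* compatibility have to be required explicitly.                               *)
HB.mixin Record isOrderedGroup G of Num.POrderedZmodule G := {
  og_le_total : forall x y : G, (x <= y) || (y <= x);
  og_lerD2l : forall z x y : G, x <= y -> z + x <= z + y
}.

#[short(type="orderedGroupType")]
HB.structure Definition OrderedGroup :=
  { G of Num.POrderedZmodule G & isOrderedGroup G }.

(* G extended by infinity: Some a is the element a of G, None is infinity. *)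
Section Infinity.
Variable G : orderedGroupType.

Definition inf_le (a b : option G) : bool :=
  match a, b with
  | _, None => true
  | None, Some _ => false
  | Some a, Some b => a <= b
  end.

Definition inf_lt (a b : option G) : bool := ~~ inf_le b a.

Definition inf_add (a b : option G) : option G :=
  match a, b with
  | Some a, Some b => Some (a + b)
  | _, _ => None
  end.

Definition inf_min (a b : option G) : option G := if inf_le a b then a else b.

End Infinity.

(* The value group of v is the set value_group v; it need not be all of G. *)
Record valuation (K : fieldType) (G : orderedGroupType) := Valuation {
  val_fun :> K -> option G;
  val_eq_inf : forall x, val_fun x = None <-> x = 0;
  valuationM : forall x y, val_fun (x * y) = inf_add (val_fun x) (val_fun y);
  valuationD : forall x y,
    inf_le (inf_min (val_fun x) (val_fun y)) (val_fun (x + y))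
}.

Section ValuedField.
Variables (K : fieldType) (G : orderedGroupType) (v : valuation K G).

Definition value_group : set G := [set a | exists x, v x = Some a].

Definition valuation_ring : set K := [set x | inf_le (Some 0) (v x)].

Definition residue_class (x : K) : set K :=
  [set y | valuation_ring y /\ inf_lt (Some 0) (v (y - x))].

Definition residue_field : set (set K) :=
  [set C | exists2 x, valuation_ring x & C = residue_class x].

End ValuedField.

Definition val_equiv (K : fieldType) (G1 G2 : orderedGroupType)
    (v1 : valuation K G1) (v2 : valuation K G2) : Prop :=
  forall x y, inf_le (v1 x) (v1 y) = inf_le (v2 x) (v2 y).

Definition val_restr (K : fieldType) (L : fieldExtType K)
    (G : orderedGroupType) (w : valuation L G) : valuation K G.
Proof.
exists (fun a : K => w a%:A).
- by move=> a; rewrite val_eq_inf; split=> [/eqP|->];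
    rewrite ?scale0r // scaler_eq0 oner_eq0 orbF => /eqP.
- by move=> a b; rewrite -in_algE rmorphM valuationM.
- by move=> a b; rewrite scalerDl; apply: valuationD.
Defined.

Section ConvexSubgroups.
Variable G : orderedGroupType.

Definition convex_subgroup (S H : set G) : Prop :=
  [/\ H `<=` S,
      H 0,
      forall a b, H a -> H b -> H (a - b)
    & forall a b c, H a -> H c -> S b -> a <= b -> b <= c -> H b].

Definition above (S H : set G) : set G :=
  [set a | S a /\ forall b, H b -> b < a].

End ConvexSubgroups.

Section ExtensionProperties.
Variables (K : fieldType) (L : splittingFieldType K) (G : orderedGroupType).
Variable w : valuation L G.

(* The canonical embedding of residue fields sends the class of a in Kv to the *)
(* class of a%:A in Lv.                                                        *)
Definition immediate : Prop :=
  value_group w `<=` value_group (val_restr w) /\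
  (forall C, residue_field w C ->
     exists2 a, valuation_ring (val_restr w) a & C = residue_class w a%:A).

Definition unique_extension : Prop :=
  forall (G1 : orderedGroupType) (w1 : valuation L G1),
    val_equiv (val_restr w) (val_restr w1) -> val_equiv w w1.

(* For p prime, and in characteristic p, these are the Artin-Schreier          *)
(* extensions that are Galois defect extensions.                               *)
Definition galois_defect (p : nat) : Prop :=
  [/\ galois 1 {:L}, \dim {:L} = p, immediate & unique_extension].

Definition Sigma (s : gal_of {:L}) : set G :=
  [set a | exists f : L, [/\ f != 0, s f != f & w ((s f - f) / f) = Some a]].

(* Sigma s is the same set for all generators s of the Galois group. *)
Definition independent_defect : Prop :=
  exists (s : gal_of {:L}) (H : set G),
    [/\ generator 'Gal({:L} / 1) s,
        convex_subgroup (value_group (val_restr w)) H,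
        H <> value_group (val_restr w)
      & Sigma s = above (value_group (val_restr w)) H].

Definition dependent_defect : Prop := ~ independent_defect.

End ExtensionProperties.

(* Valuations are considered up to equivalence, so that w extends v when the   *)
(* restriction of w to K is equivalent to v. The field is a splittingFieldType *)
(* because this is where galois is defined; it is no loss for Galois           *)
(* extensions.                                                                 *)
Record valued_extension (K : fieldType) (G : orderedGroupType)
    (v : valuation K G) := ValuedExtension {
  ext_field : splittingFieldType K;
  ext_group : orderedGroupType;
  ext_val : valuation ext_field ext_group;
  ext_valP : val_equiv v (val_restr ext_val)
}.

Definition artin_schreier_dependent (p : nat) (K : fieldType)
    (G : orderedGroupType) (v : valuation K G) (E : valued_extension v) : Prop :=
  galois_defect (ext_val E) p /\ dependent_defect (ext_val E).

(* Inside a fixed algebraic closure of K, two Galois extensions of K are       *)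
(* distinct if and only if they are not isomorphic over K.                     *)
Definition K_isomorphic (K : fieldType) (L1 L2 : fieldExtType K) : Prop :=
  exists f : {lrmorphism L1 -> L2}, bijective f.

(* Main.v *)
From HB Require Import structures.
Require Import Defs.
From mathcomp Require Import all_boot all_order all_algebra all_field.
From mathcomp Require Import all_fingroup all_solvable.
From mathcomp Require Import boolp classical_sets ring.

(** Write L = K(y) with wp y = y^p - y = b in K.  Everything takes place in K,
    in terms of the constant b.

    If L|K is a defect extension, then v(y - c) < 0 for all c in K: otherwise
    immediacy would provide a c with v(y - c) > 0, while the conjugate y - c + 1
    has value 0, against the uniqueness of the extension of v.  By immediacy
    there is an e in K that is closer to y - c than to 0.  Raising to the power
    p, e^p dominates wp (y - c) = b - wp c.  So b has the property [as_defect]: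
    each element of the coset b + wp K is, up to an error of larger value, the
    p-th power of an element e of negative value.

    Conversely, this property of b alone makes the root field of X^p - X - b a
    Galois defect extension ([artin_schreier_extension]).  As in the theory of
    pseudo-convergent sequences, polynomials f of degree less than p have
    eventually constant value when c approaches the root
    ([small_poly_dominant]), and this constant defines the value of f(y).  It
    also determines Sigma: by [Sigma_eq] it is the set [gap_values] of all
    - v(y - c), a final segment of vK consisting of positive elements.

    Let Sigma belong to a dependent defect.  Then some al in Sigma satisfies
    al < p be for all be in Sigma, for otherwise the elements smaller in absolute
    value than all of Sigma would form a convex subgroup H with
    Sigma = { be > H } ([exists_small_gap]).  After replacing y by some y - c,
    al = - v(y).  Take t in K of value - al and d = t^n.  The element d y is no
    longer a root of an Artin-Schreier polynomial over K, but it almost solves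
    X^p - X = d^p b: the error (d^p - d) y is so small, by the choice of al, that
    d^p b has again the property [as_defect], with the set of gap values shifted
    to Sigma + n al ([as_defect_scale], [gap_values_scale]).

    Finally, al > 0 makes the sets Sigma + n al pairwise distinct, so the new
    extensions are pairwise non-isomorphic.  They have dependent defect as soon
    as n > 0: if Sigma + n al were { be > H }, then al, not being in this set,
    would lie in H, and so would the element (n + 1) al of Sigma + n al. *)

Set Implicit Arguments.
Unset Strict Implicit.
Unset Printing Implicit Defensive.

Import Order.TTheory GRing.Theory.

Local Open Scope classical_set_scope.
Local Open Scope ring_scope.

Local Notation "a <=i b" := (inf_le a b) (at level 70, no associativity).
Local Notation "a <i b" := (inf_lt a b) (at level 70, no associativity).

(** * Ordered abelian groups and valuations *)
Section OrderedGroupTheory.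
Variable G : orderedGroupType.
Implicit Types x y z : G.

Lemma og_leNgt x y : (x <= y) = ~~ (y < x).
Proof.
apply: comparable_leNgt; rewrite /Order.comparable; exact: og_le_total.
Qed.

Lemma og_ltNge x y : (x < y) = ~~ (y <= x).
Proof. by rewrite og_leNgt negbK. Qed.

Lemma og_ler2l z x y : (z + x <= z + y) = (x <= y).
Proof.
apply/idP/idP => [|]; last exact: og_lerD2l.
by move/(@og_lerD2l _ (- z)); rewrite !addKr.
Qed.

Lemma og_ltr2l z x y : (z + x < z + y) = (x < y).
Proof. by rewrite !og_ltNge og_ler2l. Qed.

Lemma og_ler2r z x y : (x + z <= y + z) = (x <= y).
Proof. by rewrite !(addrC _ z) og_ler2l. Qed.

Lemma og_ltr2r z x y : (x + z < y + z) = (x < y).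
Proof. by rewrite !(addrC _ z) og_ltr2l. Qed.

Lemma og_leD x y z t : x <= y -> z <= t -> x + z <= y + t.
Proof.
by move=> xy zt; apply: (@le_trans _ _ (y + z)); rewrite ?og_ler2l ?og_ler2r.
Qed.

Lemma og_ltleD x y z t : x < y -> z <= t -> x + z < y + t.
Proof.
by move=> xy zt; apply: (@lt_le_trans _ _ (y + z)); rewrite ?og_ler2l ?og_ltr2r.
Qed.

Lemma og_leN x y : (- x <= - y) = (y <= x).
Proof. by rewrite -[LHS](og_ler2l (x + y)) addrK addrAC subrr add0r. Qed.

Lemma og_ltN x y : (- x < - y) = (y < x).
Proof. by rewrite !og_ltNge og_leN. Qed.

Lemma og_le_mulrn n x y : x <= y -> x *+ n <= y *+ n.
Proof.
move=> xy; elim: n => [|n IH]; first by rewrite !mulr0n.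
by rewrite !mulrS og_leD.
Qed.

Implicit Types a b c : option G.

Lemma inf_lexx a : a <=i a. Proof. by case: a => //= a; rewrite lexx. Qed.

Lemma inf_le_trans b a c : a <=i b -> b <=i c -> a <=i c.
Proof. by case: a b c => [a|] [b|] [c|] //=; apply: le_trans. Qed.

Lemma inf_ltNge a b : (a <i b) = ~~ (b <=i a). Proof. by []. Qed.

Lemma inf_leNgt a b : (a <=i b) = ~~ (b <i a).
Proof. by rewrite /inf_lt negbK. Qed.

Lemma inf_ltW a b : a <i b -> a <=i b.
Proof. by case: a b => [a|] [b|] //=; rewrite /inf_lt /= -og_ltNge => /ltW. Qed.

Lemma inf_le_lt_trans b a c : a <=i b -> b <i c -> a <i c.
Proof. by move=> ab; apply: contra => ca; apply: inf_le_trans ca ab. Qed.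

Lemma inf_lt_le_trans b a c : a <i b -> b <=i c -> a <i c.
Proof. by move=> ab bc; apply: contra ab; apply: inf_le_trans bc. Qed.

Lemma inf_lt_trans b a c : a <i b -> b <i c -> a <i c.
Proof. by move=> /inf_ltW; apply: inf_le_lt_trans. Qed.

Lemma inf_ltxx a : (a <i a) = false.
Proof. by rewrite /inf_lt inf_lexx. Qed.

Lemma inf_le_anti a b : a <=i b -> b <=i a -> a = b.
Proof.
case: a b => [a|] [b|] //= ab ba; congr Some.
by apply/eqP; rewrite eq_le ab ba.
Qed.

Lemma inf_lt_total a b : a <> b -> a <i b \/ b <i a.
Proof.
move=> ne; case: (boolP (a <i b)) => [|/negP nab]; first by left.
case: (boolP (b <i a)) => [|/negP nba]; first by right.
by case: ne; apply: inf_le_anti; rewrite inf_leNgt; apply/negP.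
Qed.

Lemma inf_lt_Some x y : (Some x <i Some y) = (x < y).
Proof. by rewrite /inf_lt /= -og_ltNge. Qed.

Lemma inf_le_min a b c : a <=i b -> a <=i c -> a <=i inf_min b c.
Proof. by rewrite /inf_min; case: ifP. Qed.

Lemma inf_lt_min a b c : a <i b -> a <i c -> a <i inf_min b c.
Proof. by rewrite /inf_min; case: ifP. Qed.

End OrderedGroupTheory.

Section ValuationTheory.
Variables (F : fieldType) (G : orderedGroupType) (v : valuation F G).
Implicit Types x y z t : F.

Lemma val_zero : v 0 = None. Proof. by apply/val_eq_inf. Qed.

Lemma val_fin x : x != 0 -> exists a, v x = Some a.
Proof.
move=> x0; case E: (v x) => [a|]; first by exists a.
by case/eqP: x0; apply/(val_eq_inf v).
Qed.

Lemma val_lt_neq0 x y : v x <i v y -> x != 0.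
Proof. by apply: contraTneq => ->; rewrite val_zero /inf_lt; case: (v y). Qed.

Lemma val_lt0 x : (v x <i v 0) = (x != 0).
Proof.
apply/idP/idP => [/val_lt_neq0 //|/val_fin [a E]].
by rewrite val_zero E.
Qed.

Lemma val_eqM x y z t : v x = v y -> v z = v t -> v (x * z) = v (y * t).
Proof. by rewrite !valuationM => -> ->. Qed.

Lemma val_leM x y z t : v x <=i v y -> v z <=i v t -> v (x * z) <=i v (y * t).
Proof.
rewrite !valuationM; case: (v x) (v y) (v z) (v t) => [a|] [b|] [c|] [d|] //=.
exact: og_leD.
Qed.

Lemma val_ltM x y z t :
  v x <i v y -> v z <=i v t -> z != 0 -> v (x * z) <i v (y * t).
Proof.
move=> xy zt z0; have [a xa] := val_fin (val_lt_neq0 xy).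
have [c zc] := val_fin z0; move: xy zt; rewrite !valuationM xa zc.
case: (v y) (v t) => [b|] [d|] //=; rewrite !inf_lt_Some.
exact: og_ltleD.
Qed.

Lemma val_leM2r z x y : z != 0 -> (v (x * z) <=i v (y * z)) = (v x <=i v y).
Proof.
move=> z0; apply/idP/idP => [h|h]; last exact: val_leM h (inf_lexx _).
by move: (val_leM h (inf_lexx (v z^-1))); rewrite !mulfK.
Qed.

Lemma val_ltM2r z x y : z != 0 -> (v (x * z) <i v (y * z)) = (v x <i v y).
Proof. by move=> z0; rewrite !inf_ltNge val_leM2r. Qed.

Lemma val_leM2l z x y : z != 0 -> (v (z * x) <=i v (z * y)) = (v x <=i v y).
Proof. by move=> z0; rewrite !(mulrC z) val_leM2r. Qed.

Lemma val_ltM2l z x y : z != 0 -> (v (z * x) <i v (z * y)) = (v x <i v y).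
Proof. by move=> z0; rewrite !(mulrC z) val_ltM2r. Qed.

Lemma val_one : v 1 = Some 0.
Proof.
have [a E] := val_fin (oner_neq0 F); rewrite E; congr Some.
have := valuationM v 1 1; rewrite mulr1 E /= => -[] /eqP.
by rewrite -subr_eq0 opprD addNKr oppr_eq0 => /eqP.
Qed.

Lemma valX_Some x a n : v x = Some a -> v (x ^+ n) = Some (a *+ n).
Proof.
move=> E; elim: n => [|n IH]; first by rewrite expr0 val_one mulr0n.
by rewrite exprS valuationM E IH /= mulrS.
Qed.

Lemma valV_Some x a : v x = Some a -> v x^-1 = Some (- a).
Proof.
move=> E; have x0 : x != 0 by apply/eqP => x0; move: E; rewrite x0 val_zero.
have [b Eb] : exists b, v x^-1 = Some b by apply: val_fin; rewrite invr_eq0.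
have := valuationM v x x^-1; rewrite mulfV // val_one E Eb /= => -[] /esym/eqP.
by rewrite addrC addr_eq0 => /eqP ->.
Qed.

Lemma val_leX x y n : v x <=i v y -> v (x ^+ n) <=i v (y ^+ n).
Proof.
move=> h; elim: n => [|n IH]; first by rewrite !expr0 inf_lexx.
by rewrite !exprS val_leM.
Qed.

Lemma val_ltX x y n : (0 < n)%N -> v x <i v y -> v (x ^+ n) <i v (y ^+ n).
Proof.
case: n => // n _ h; rewrite !exprS val_ltM ?val_leX ?inf_ltW //.
by rewrite expf_neq0 // (val_lt_neq0 h).
Qed.

Lemma val_leXE x y n : (0 < n)%N -> (v (x ^+ n) <=i v (y ^+ n)) = (v x <=i v y).
Proof.
move=> n0; apply/idP/idP => [|]; last exact: val_leX.
by rewrite !inf_leNgt; apply: contra; apply: val_ltX.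
Qed.

Lemma val_ltXE x y n : (0 < n)%N -> (v (x ^+ n) <i v (y ^+ n)) = (v x <i v y).
Proof. by move=> n0; rewrite !inf_ltNge val_leXE. Qed.

Lemma val_eqXE x y n : (0 < n)%N -> v (x ^+ n) = v (y ^+ n) -> v x = v y.
Proof.
move=> n0 e; apply: inf_le_anti; rewrite -(val_leXE _ _ n0) e; exact: inf_lexx.
Qed.

Lemma val_eqX x y n : v x = v y -> v (x ^+ n) = v (y ^+ n).
Proof. by move=> e; apply: inf_le_anti; apply: val_leX; rewrite e inf_lexx. Qed.

Lemma val_ltX_self x n : (1 < n)%N -> v x <i v 1 -> v (x ^+ n) <i v x.
Proof.
case: n => [|[|n]] // _ h; rewrite exprSr -{3}[x]mul1r val_ltM2r.
  by rewrite -(expr1n _ n.+1) val_ltX.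
exact: val_lt_neq0 h.
Qed.

Lemma val_unity x n : (0 < n)%N -> x ^+ n = 1 -> v x = v 1.
Proof. by move=> n0 e; apply: (val_eqXE n0); rewrite e expr1n. Qed.

Lemma val_opp x : v (- x) = v x.
Proof.
rewrite -mulN1r -[in RHS](mul1r x); apply: val_eqM => //.
by apply: (@val_unity _ 2) => //; rewrite sqrrN expr1n.
Qed.

Lemma val_subC x y : v (x - y) = v (y - x).
Proof. by rewrite -val_opp opprB. Qed.

Lemma val_leD z x y : v z <=i v x -> v z <=i v y -> v z <=i v (x + y).
Proof.
by move=> zx zy; apply: (inf_le_trans (inf_le_min zx zy)); apply: valuationD.
Qed.

Lemma val_ltD z x y : v z <i v x -> v z <i v y -> v z <i v (x + y).
Proof.
by move=> zx zy; apply: (inf_lt_le_trans (inf_lt_min zx zy)); apply: valuationD.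
Qed.

Lemma val_leB z x y : v z <=i v x -> v z <=i v y -> v z <=i v (x - y).
Proof. by move=> zx zy; apply: val_leD => //; rewrite val_opp. Qed.

Lemma val_ltB z x y : v z <i v x -> v z <i v y -> v z <i v (x - y).
Proof. by move=> zx zy; apply: val_ltD => //; rewrite val_opp. Qed.

Lemma val_lt_sum (I : Type) (r : seq I) (P : pred I) (f : I -> F) z :
  z != 0 -> (forall i, P i -> v z <i v (f i)) ->
  v z <i v (\sum_(i <- r | P i) f i).
Proof.
move=> z0 h; elim/big_ind: _ => [|x y|//]; first by rewrite val_lt0.
exact: val_ltD.
Qed.

Lemma val_addr x y : v x <i v y -> v (x + y) = v x.
Proof.
move=> xy; apply: inf_le_anti; last by apply: val_leD; rewrite ?inf_lexx ?inf_ltW.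
rewrite inf_leNgt; apply/negP => h; have := val_ltB h xy.
by rewrite addrK inf_ltxx.
Qed.

(** An element closer to x than x is to 0 has the value of x; immediacy and
    the approximation arguments below are all used through this. *)
Lemma val_close x y : v x <i v (y - x) -> v y = v x.
Proof. by move=> h; rewrite -(val_addr h) addrC subrK. Qed.

End ValuationTheory.

(** * The Artin-Schreier map *)

(** The Weierstrass p of Artin-Schreier theory. *)
Definition wp (R : nzRingType) (p : nat) (x : R) : R := x ^+ p - x.

Section ArtinSchreierMap.
Variables (F : fieldType) (p : nat) (hp : p \in [pchar F]).
Implicit Types x y : F.

Let p_gt0 : (0 < p)%N. Proof. exact/prime_gt0/(pcharf_prime hp). Qed.

Lemma wpD x y : wp p (x + y) = wp p x + wp p y.
Proof. by rewrite /wp -!(pFrobenius_autE hp) rmorphD opprD addrACA. Qed.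

Lemma wpB x y : wp p (x - y) = wp p x - wp p y.
Proof.
by rewrite /wp -!(pFrobenius_autE hp) rmorphB opprD [in RHS]opprD addrACA.
Qed.

Variables (G : orderedGroupType) (v : valuation F G).

(** Such a u is a nonzero element of the prime field, for instance the
    difference of two conjugate Artin-Schreier generators. *)
Lemma val_frob_fixed u : u != 0 -> u ^+ p = u -> v u = v 1.
Proof.
move=> u0 e; apply: (@val_unity _ _ _ _ p.-1).
  by rewrite -subn1 subn_gt0 prime_gt1 ?(pcharf_prime hp).
by apply: (mulfI u0); rewrite -exprS prednK // mulr1.
Qed.

Lemma val_natr_pchar n : ~~ (p %| n)%N -> v n%:R = v 1.
Proof.
rewrite (dvdn_pcharf hp) => n0; apply: val_frob_fixed n0 _.
by rewrite -(pFrobenius_autE hp) pFrobenius_aut_nat.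
Qed.

Lemma val_wp_neg x : v x <i v 1 -> v (wp p x) = v (x ^+ p).
Proof.
by move=> x1; apply: val_addr; rewrite val_opp val_ltX_self ?prime_gt1 ?(pcharf_prime hp).
Qed.

Lemma val_wp_nneg x : v 1 <=i v x -> v 1 <=i v (wp p x).
Proof. by move=> h; apply: val_leB => //; rewrite -(expr1n _ p) val_leX. Qed.

(** For v x >= 0 also v (wp x) >= 0, so a negative value of wp x forces the p-th
    power to dominate. *)
Lemma val_wp_inj x e : v e <i v 1 -> v (wp p x) = v (e ^+ p) -> v x = v e.
Proof.
move=> e1 h; have ep1 : v (e ^+ p) <i v 1 by rewrite -(expr1n _ p) val_ltX.
case: (boolP (v x <i v 1)) => [x1|].
  by apply: (val_eqXE p_gt0); rewrite -h val_wp_neg.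
rewrite -inf_leNgt => /val_wp_nneg; rewrite h => h1.
by have := inf_lt_le_trans ep1 h1; rewrite inf_ltxx.
Qed.

Lemma val_wp_le x e : v e <i v 1 -> v (e ^+ p) <=i v (wp p x) -> v e <=i v x.
Proof.
move=> e1 h; case: (boolP (v x <i v 1)) => [x1|].
  by rewrite -(val_leXE _ _ _ p_gt0) -(val_wp_neg x1).
by rewrite -inf_leNgt => h1; apply: inf_le_trans h1; apply: inf_ltW.
Qed.

End ArtinSchreierMap.

Lemma taylor_shift (F : fieldType) (f : {poly F}) (x c : F) :
  f.[x] = f.[c] + \sum_(i < size f) f^`N(i.+1).[c] * (x - c) ^+ i.+1.
Proof.
have -> : f.[x] = f.[c + (x - c)] by rewrite addrC subrK.
rewrite (@nderiv_taylor_wide _ (size f).+1) //; last exact: mulrC.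
by rewrite big_ord_recl nderivn0 expr0 mulr1.
Qed.

Lemma val_dominant_taylor (F : fieldType) (G : orderedGroupType) (v : valuation F G)
    (f : {poly F}) (x c e : F) :
  (forall i, (0 < i)%N -> v f.[c] <i v (f^`N(i).[c] * e ^+ i)) ->
  v e <=i v (x - c) -> v f.[c] <i v (f.[x] - f.[c]).
Proof.
move=> h ex; have c0 := val_lt_neq0 (h 1%N isT).
rewrite (taylor_shift f x c) addrAC subrr add0r.
apply: val_lt_sum => // i _; apply: (inf_lt_le_trans (h i.+1 isT)).
by apply: val_leM; rewrite ?inf_lexx ?val_leX.
Qed.

(** * Approximation of a root of X^p - X - b by elements of K *)

(** The constants b for which X^p - X - b generates a defect extension: if y is
    a root, then e stands for an element of K that is closer to y - c than to 0,
    and b - wp c = wp (y - c). *)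
Definition as_defect (K : fieldType) (G : orderedGroupType) (v : valuation K G)
    (p : nat) (b : K) : Prop :=
  forall c, exists e, v e <i v 1 /\ v (e ^+ p) <i v (b - wp p c - e ^+ p).

Section Approximation.
Variables (K : fieldType) (p : nat) (hp : p \in [pchar K]).
Variables (G : orderedGroupType) (v : valuation K G) (b : K) (gap : K -> K).
Hypothesis gap_neg : forall c, v (gap c) <i v 1.
Hypothesis gap_approx :
  forall c, v (gap c ^+ p) <i v (b - wp p c - gap c ^+ p).
Implicit Types (c d x : K) (f g : {poly K}).

Let p_prime : prime p. Proof. exact: pcharf_prime hp. Qed.
Let p_gt0 : (0 < p)%N. Proof. exact: prime_gt0. Qed.
Let p_gt1 : (1 < p)%N. Proof. exact: prime_gt1. Qed.

Lemma gap_neq0 c : gap c != 0.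
Proof. exact: val_lt_neq0 (gap_neg c). Qed.

Lemma gapE c : v (b - wp p c) = v (gap c ^+ p).
Proof. exact: val_close (gap_approx c). Qed.

(** Correcting c by gap c improves the approximation: the new difference
    b - wp (c + gap c) is the old error term plus gap c, and gap c has larger
    value than its p-th power. *)
Lemma gap_unbounded c : v (gap c) <i v (gap (c + gap c)).
Proof.
rewrite -(val_ltXE _ _ _ p_gt0) -[v (gap (_ + _) ^+ p)]gapE.
have -> : b - wp p (c + gap c) = (b - wp p c - gap c ^+ p) + gap c.
  by rewrite wpD // opprD addrA [wp p (gap c)]/wp (opprB (gap c ^+ p)) addrA addrAC.
by apply: val_ltD; [apply: gap_approx | apply: val_ltX_self].
Qed.

Lemma gap_dist c d : v (gap c) <i v (gap d) -> v (d - c) = v (gap c).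
Proof.
move=> cd; apply: (val_wp_inj hp) => //.
have -> : wp p (d - c) = (b - wp p c) - (b - wp p d).
  by rewrite wpB // (opprB b) [RHS]addrC addrA subrK.
by rewrite val_addr ?val_opp gapE // gapE val_ltX.
Qed.

Lemma gap_dist_le c d : v (gap c) <=i v (gap d) -> v (gap c) <=i v (d - c).
Proof.
move=> cd; apply: (val_wp_le hp) => //.
have -> : wp p (d - c) = (b - wp p c) - (b - wp p d).
  by rewrite wpB // (opprB b) [RHS]addrC addrA subrK.
by apply: val_leB; rewrite gapE ?inf_lexx // val_leX.
Qed.

(** The statement Q holds eventually as c approaches the root: c is the closer
    to the root the larger v (gap c) is. *)
Definition near (Q : K -> Prop) : Prop :=
  exists c0, forall c, v (gap c0) <=i v (gap c) -> Q c.

Lemma nearW (Q : K -> Prop) : (forall c, Q c) -> near Q.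
Proof. by move=> h; exists 0. Qed.

Lemma nearI (P Q : K -> Prop) : near P -> near Q -> near (fun c => P c /\ Q c).
Proof.
move=> [c hc] [d hd].
case: (boolP (v (gap c) <=i v (gap d))) => [cd|].
  by exists d => x dx; split; [apply: hc; apply: inf_le_trans dx | apply: hd].
rewrite -inf_ltNge => /inf_ltW dc.
by exists c => x dx; split; [apply: hc | apply: hd; apply: inf_le_trans dx].
Qed.

Lemma near_imp (P Q : K -> Prop) : (forall c, P c -> Q c) -> near P -> near Q.
Proof. by move=> PQ [c hc]; exists c => x cx; apply/PQ/hc. Qed.

Lemma near_ex (Q : K -> Prop) : near Q -> exists c, Q c.
Proof. by move=> [c hc]; exists c; apply/hc/inf_lexx. Qed.

Lemma near_all (Q : nat -> K -> Prop) n :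
  (forall i, (i < n)%N -> near (Q i)) ->
  near (fun c => forall i, (i < n)%N -> Q i c).
Proof.
elim: n => [|n IH] h; first exact: nearW.
have h1 := IH (fun i ni => h i (ltnW ni)).
apply: near_imp (nearI h1 (h n (ltnSn n))) => c [hc hn] i.
by rewrite ltnS leq_eqVlt => /orP[/eqP -> // | /hc].
Qed.

Lemma near_gt c : near (fun d => v (gap c) <i v (gap d)).
Proof.
by exists (c + gap c) => d; apply: inf_lt_le_trans; apply: gap_unbounded.
Qed.

Lemma gap_not_eventually_const a n :
  (0 < n)%N -> ~ near (fun c => v (gap c ^+ n) = v a).
Proof.
move=> n0 [c hc]; have := val_ltX n0 (gap_unbounded c).
by rewrite !hc ?inf_ltxx ?inf_lexx // inf_ltW ?gap_unbounded.
Qed.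

(** In the Taylor expansion of f at c, the constant term strictly dominates on
    the ball of radius gap c.  This pins down the value of f at all points of
    that ball, those of K and the root itself. *)
Definition dominant f c : Prop :=
  forall i, (0 < i)%N -> v f.[c] <i v (f^`N(i).[c] * gap c ^+ i).

Lemma dominant_val f c d :
  dominant f c -> v (gap c) <=i v (gap d) -> v f.[d] = v f.[c].
Proof.
by move=> fc cd; apply: val_close; apply: val_dominant_taylor fc (gap_dist_le cd).
Qed.

Lemma near_dominant_val f : near (dominant f) ->
  exists2 a, a != 0 & near (fun c => v f.[c] = v a).
Proof.
move=> [c hc]; have fc := hc c (inf_lexx _).
exists f.[c]; first exact: val_lt_neq0 (fc 1%N isT).
by exists c => d; apply: dominant_val.
Qed.

Lemma nderivn_deriv f i : (f^`())^`N(i) = f^`N(i.+1) *+ i.+1.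
Proof.
apply/polyP => j; rewrite coef_nderivn coef_deriv coefMn coef_nderivn.
rewrite -!mulrnA addSn; congr (_ *+ _).
by rewrite [RHS]mulnC -mul_bin_diag.
Qed.

Lemma dominant_deriv_lt f c i : (size f <= p)%N -> dominant f^`() c -> (1 < i)%N ->
  v (f^`()).[c] <i v (f^`N(i).[c] * gap c ^+ i.-1).
Proof.
move=> sf h i1; have c0 := val_lt_neq0 (h 1%N isT).
case: (leqP (size f) i) => [/nderivn_poly0 ->|si].
  by rewrite horner0 mul0r val_lt0.
have := h i.-1; rewrite nderivn_deriv prednK ?(ltnW i1) // => /(_ _)/inf_lt_le_trans.
apply; first by rewrite -subn1 subn_gt0.
rewrite hornerMn -mulr_natr -mulrA [_%:R * _]mulrC mulrA.
rewrite -{2}[_ * gap c ^+ _]mulr1; apply: val_leM; rewrite ?inf_lexx //.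
rewrite (val_natr_pchar hp) ?inf_lexx // gtnNdvd ?(ltnW i1) //.
exact: leq_trans si sf.
Qed.

(** Dominance of f' makes the linear term dominate all higher ones in the Taylor
    expansion of f, because the integers below p are units.  If f itself is not
    dominant at points d arbitrarily close to the root, then f.[d] has at least
    the value of the linear term there; seen from a point c further away, f.[c]
    must cancel the linear term of the expansion at c. *)
Lemma nondominant_val f : (size f <= p)%N ->
  near (dominant f^`()) -> ~ near (dominant f) ->
  exists2 a, a != 0 & near (fun c => v f.[c] = v (a * gap c)).
Proof.
move=> sf df nf; have [a a0 fa] := near_dominant_val df; exists a => //.
have [c0 hc0] := nearI df fa; exists c0 => c c0c.
have [dfc fac] := hc0 c c0c.
have [d [cd [k k0 dk]]] : exists d, v (gap c) <i v (gap d) /\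
    exists2 i, (0 < i)%N & v (f^`N(i).[d] * gap d ^+ i) <=i v f.[d].
  apply: contrapT => H; apply: nf; have [c1 hc1] := near_gt c.
  exists c1 => d /hc1 cd i i0; rewrite inf_ltNge; apply/negP => le.
  by apply: H; exists d; split => //; exists i.
have c0d : v (gap c0) <=i v (gap d) by apply: inf_le_trans c0c _; apply: inf_ltW.
have [dfd fad] := hc0 d c0d.
have fd : v (a * gap d) <=i v f.[d].
  apply: inf_le_trans dk; rewrite (val_eqM (esym fad) (erefl (v (gap d)))).
  case: k k0 => [//|[_|k _]]; first by rewrite nderivn1 expr1 inf_lexx.
  rewrite exprSr mulrA val_leM2r ?gap_neq0 //; apply: inf_ltW.
  exact: (dominant_deriv_lt sf dfd (i := k.+2)).
have dc := gap_dist cd.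
have -> : f.[c] = f.[d] - \sum_(i < size f) f^`N(i.+1).[c] * (d - c) ^+ i.+1.
  by rewrite [in RHS](taylor_shift f d c) addrK.
have nz : (0 < size f)%N.
  by rewrite lt0n size_poly_eq0; apply/eqP => f0; move: fac;
     rewrite f0 deriv0 horner0 => /esym; rewrite val_zero => /val_eq_inf /eqP;
     rewrite (negPf a0).
case E: (size f) nz => [//|n] _; rewrite big_ord_recl nderivn1 expr1 addrC.
have vac : v (- ((f^`()).[c] * (d - c))) = v (a * gap c) by rewrite val_opp; apply: val_eqM.
rewrite opprD -addrA val_addr // vac.
have agc : a * gap c != 0 by rewrite mulf_neq0 ?gap_neq0.
apply: val_ltD.
  rewrite val_opp; apply: val_lt_sum => // i _.
  rewrite exprSr mulrA; rewrite -(val_eqM fac dc).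
  rewrite val_ltM2r -?(val_lt0 v) ?dc ?val_lt0 ?gap_neq0 //.
  rewrite (val_eqM (erefl (v f^`N(i.+2).[c])) (val_eqX i.+1 dc)).
  exact: (dominant_deriv_lt sf dfc (i := i.+2)).
by apply: inf_lt_le_trans fd; rewrite val_ltM2l.
Qed.

Definition wp_poly : {poly K} := 'X^p - 'X - b%:P.

Lemma horner_wp_poly c : wp_poly.[c] = wp p c - b.
Proof. by rewrite !hornerE. Qed.

Lemma size_wp_poly : size wp_poly = p.+1.
Proof.
rewrite /wp_poly -addrA size_polyDl ?size_polyXn // ltnS -opprD size_polyN.
apply: leq_trans (size_polyD _ _) _; rewrite geq_max size_polyX p_gt1 /=.
exact: leq_trans (size_polyC_leq1 _) (ltnW p_gt1).
Qed.

Lemma wp_poly_neq0 : wp_poly != 0.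
Proof. by rewrite -size_poly_eq0 size_wp_poly. Qed.

Lemma val_wp_poly c : v wp_poly.[c] = v (gap c ^+ p).
Proof. by rewrite horner_wp_poly val_subC gapE. Qed.

(** By repeated division by f: dividing g by f leaves a remainder of eventually
    constant value, and in a sum of a constant and a term whose value increases
    strictly one of the two eventually wins. *)
Lemma monomial_val f a : (1 < size f)%N ->
  (forall g, g != 0 -> (size g < size f)%N -> near (dominant g)) ->
  a != 0 -> near (fun c => v f.[c] = v (a * gap c)) ->
  forall g, g != 0 -> exists d k, [/\ d != 0, (k * (size f).-1 < size g)%N
    & near (fun c => v g.[c] = v (d * gap c ^+ k))].
Proof.
move=> sf1 hlt a0 fa g; move: {2}(size g) (leqnn (size g)) => n.
have f0 : f != 0 by rewrite -size_poly_gt0 ltnW.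
elim: n g => [|n IH] g sg g0.
  by move: sg; rewrite leqn0 size_poly_eq0 (negPf g0).
case: (ltnP (size g) (size f)) => [sgf|sfg].
  have [d d0 hd] := near_dominant_val (hlt g g0 sgf).
  exists d, 0%N; rewrite size_poly_gt0; split => //.
  by apply: near_imp hd => c; rewrite expr0 mulr1.
have sq : size (g %/ f) = (size g - (size f).-1)%N := size_divp _ f0.
have sf0 : (0 < (size f).-1)%N by rewrite -subn1 subn_gt0.
have sfg' : ((size f).-1 < size g)%N by rewrite prednK // ltnW.
have q0 : g %/ f != 0 by rewrite -size_poly_gt0 sq subn_gt0.
have [||d [k [d0 hk hd]]] := IH (g %/ f) => //.
  by rewrite sq leq_subLR; apply: leq_trans sg _; rewrite -(add1n n) leq_add2r.
pose r := g %% f.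
have hg c : g.[c] = (g %/ f).[c] * f.[c] + r.[c].
  by rewrite {1}(divp_eq g f) hornerD hornerM.
have hqf : near (fun c => v ((g %/ f).[c] * f.[c]) = v (d * a * gap c ^+ k.+1)).
  apply: near_imp (nearI hd fa) => c [e1 e2]; rewrite (val_eqM e1 e2).
  by rewrite mulrACA -exprSr.
have hk' : (k.+1 * (size f).-1 < size g)%N.
  by rewrite mulSn addnC -(subnK (ltnW sfg')) ltn_add2r -sq.
have da0 : d * a != 0 by rewrite mulf_neq0.
have [r0|r0] := eqVneq r 0.
  exists (d * a), k.+1; split => //; apply: near_imp hqf => c <-.
  by rewrite hg r0 horner0 addr0.
have [s s0 hs] : exists2 s, s != 0 & near (fun c => v r.[c] = v s).
  by apply: near_dominant_val; apply: hlt => //; rewrite /r ltn_modp.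
have [[c0 hc0]|H] := pselect (exists c0, v s <=i v (d * a * gap c0 ^+ k.+1)).
  exists s, 0%N; rewrite mul0n size_poly_gt0; split => //.
  apply: near_imp (nearI (near_gt c0) (nearI hqf hs)) => c [c0c [e1 e2]].
  rewrite expr0 mulr1 hg addrC val_addr // e1 e2.
  by apply: inf_le_lt_trans hc0 _; rewrite val_ltM2l // val_ltX.
exists (d * a), k.+1; split => //.
apply: near_imp (nearI hqf hs) => c [e1 e2].
rewrite hg val_addr // e1 e2 inf_ltNge; apply/negP => le.
by apply: H; exists c.
Qed.

(** A counterexample f of least degree m would make v (wp_poly.[c]) a monomial
    in gap c of degree at most p / m, but this value is v (gap c ^+ p) and the
    values of the gaps have no maximum.  So m = 1, and f would have a root in K
    that is at least as close as all approximations. *)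
Lemma small_poly_dominant f : f != 0 -> (size f <= p)%N -> near (dominant f).
Proof.
move: {2}(size f) (leqnn (size f)) => n.
elim: n f => [|n IH] f sf f0 sfp.
  by move: sf; rewrite leqn0 size_poly_eq0 (negPf f0).
case: (leqP (size f) 1) => [sf1|sf1].
  apply: nearW => c i i0; rewrite nderivn_poly0 ?(leq_trans sf1) // horner0 mul0r.
  rewrite val_lt0; move/size1_polyC: sf1 => e.
  by move: f0; rewrite e hornerC polyC_eq0.
apply: contrapT => nf.
have hlt g : g != 0 -> (size g < size f)%N -> near (dominant g).
  move=> g0 sg; apply: IH => //; first by rewrite -ltnS (leq_trans sg).
  exact: leq_trans (ltnW sg) sfp.
have f'0 : f^`() != 0.
  have : (f^`())`_(size f).-2 != 0.
    rewrite coef_deriv prednK -?subn1 ?subn_gt0 // subn1 -mulr_natr mulf_neq0 //.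
      by rewrite -lead_coefE lead_coef_eq0.
    rewrite -(dvdn_pcharf hp) gtnNdvd -?subn1 ?subn_gt0 //.
    by rewrite subn1 prednK ?(ltnW sf1).
  by apply: contraNneq => ->; rewrite coef0.
have [a a0 fa] := nondominant_val sfp (hlt _ f'0 (lt_size_deriv f0)) nf.
have [d [k [d0 hk hd]]] := monomial_val sf1 hlt a0 fa wp_poly_neq0.
have hP : near (fun c => v (gap c ^+ p) = v (d * gap c ^+ k)).
  by apply: near_imp hd => c <-; rewrite val_wp_poly.
case: (ltnP k p) => [kp|pk].
  apply: (@gap_not_eventually_const d (p - k)); first by rewrite subn_gt0.
  apply: near_imp hP => c; rewrite -(subnK (ltnW kp)) exprD addnK => e.
  apply: inf_le_anti; rewrite -(@val_leM2r _ _ _ (gap c ^+ k)) ?e ?inf_lexx //;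
    by rewrite expf_neq0 ?gap_neq0.
(* k = p leaves only a linear f, with a root x in K *)
have sf2 : size f = 2%N.
  apply/eqP; rewrite eqn_leq sf1 andbT leqNgt; apply/negP => sf2.
  move: hk; rewrite size_wp_poly ltnS leqNgt => /negP; apply.
  have := leq_mul pk (_ : 2 <= (size f).-1)%N; rewrite muln2 -addnn => h.
  apply: leq_trans (h _); first by rewrite -{1}(addn0 p) ltn_add2l.
  by rewrite -ltnS prednK // ltnW.
have f1 : f`_1 != 0 by have := lead_coef_eq0 f; rewrite lead_coefE sf2 /= => ->.
pose x := - f`_0 / f`_1.
have fx c : f.[c] = f`_1 * (c - x).
  rewrite horner_coef sf2 !big_ord_recl big_ord0 /= expr0 expr1 mulr1 addr0.
  by rewrite /x mulNr opprK mulrDr mulrCA mulfV // mulr1 addrC.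
have hx : near (fun c => v (f`_1 * (c - x)) = v (f`_1 * gap x)).
  by apply: near_imp (near_gt x) => c /gap_dist e; apply: val_eqM.
apply: (@gap_not_eventually_const (f`_1 * gap x / a) 1) => //.
apply: near_imp (nearI fa hx) => c [e1 e2].
have <- : v (a * gap c / a) = v (f`_1 * gap x / a).
  by apply: val_eqM => //; rewrite -e1 fx.
by rewrite expr1 mulrAC mulfV // mul1r.
Qed.

(** The factors of a proper factorization would have eventually constant value,
    but the values of wp_poly increase strictly. *)
Lemma wp_poly_irr : irreducible_poly wp_poly.
Proof.
split; first by rewrite size_wp_poly ltnS ltnW.
move=> q sq1 qP; have [r e] := dvdpP _ _ qP.
have := wp_poly_neq0; rewrite e mulf_eq0 negb_or => /andP[r0 q0].
have sE : (size r + size q = p.+2)%N.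
  by have := size_mul r0 q0; rewrite -e size_wp_poly; move: (size_poly_gt0 r);
     rewrite r0; case: (size r) => // n _; rewrite addSn /= => ->.
have q_gt0 : (0 < size q)%N by rewrite size_poly_gt0.
have r_gt0 : (0 < size r)%N by rewrite size_poly_gt0.
have q_gt1 : (1 < size q)%N by rewrite ltn_neqAle eq_sym sq1.
have sr : (size r <= p)%N.
  by rewrite -ltnS -ltnS -sE -[(size r).+2]addn2 leq_add2l.
case: (leqP (size q) p) => [sqp|sqp].
  have [a a0 ha] := near_dominant_val (small_poly_dominant r0 sr).
  have [d d0 hd] := near_dominant_val (small_poly_dominant q0 sqp).
  case: (@gap_not_eventually_const (a * d) p) => //.
  apply: near_imp (nearI ha hd) => c [e1 e2].
  by rewrite -val_wp_poly e hornerM; apply: val_eqM.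
rewrite -e -(dvdp_size_eqp qP) size_wp_poly eqn_leq sqp andbT.
by rewrite -ltnS -sE -{1}(add0n (size q)) ltn_add2r.
Qed.

End Approximation.

(** * Valuations on an extension containing the root *)
Lemma pow_in_alg (K : fieldType) (L : fieldExtType K) (a : K) n :
  (a ^+ n)%:A = a%:A ^+ n :> L.
Proof. by rewrite -!in_algE rmorphXn. Qed.

Lemma wp_in_alg (K : fieldType) (L : fieldExtType K) p (a : K) :
  wp p a%:A = (wp p a)%:A :> L.
Proof. by rewrite /wp scalerBl pow_in_alg. Qed.

Lemma adjoin_poly_exists (K : fieldType) (L : fieldExtType K) (y : L) :
  <<1; y>>%VS = fullv -> forall x : L, exists f : {poly K},
  (size f <= \dim {:L})%N /\ x = (map_poly (in_alg L) f).[y].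
Proof.
move=> gen x; have [f ef] := polyOver1P (Fadjoin_polyOver 1 y x).
exists f; split; last by rewrite -ef Fadjoin_poly_eq // gen memvf.
rewrite -(size_map_poly (in_alg L)) -ef; apply: leq_trans (size_Fadjoin_poly _ _ _) _.
by rewrite adjoin_degreeE gen dimv1 divn1.
Qed.

Lemma adjoin_poly_root (K : fieldType) (L : fieldExtType K) (y : L) (f : {poly K}) :
  <<1; y>>%VS = fullv -> (size f <= \dim {:L})%N ->
  (map_poly (in_alg L) f).[y] = 0 -> f = 0.
Proof.
move=> gen sf /eqP; rewrite -/(root _ y) => fy; apply/eqP/contraT => f0.
have ff : map_poly (in_alg L) f \is a polyOver 1%VS by apply/polyOver1P; exists f.
have := dvdp_leq _ (minPoly_dvdp ff fy); rewrite map_poly_eq0 size_map_poly => /(_ f0).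
by rewrite size_minPoly adjoin_degreeE gen dimv1 divn1 ltnNge sf.
Qed.

Lemma val_equiv_lt (F : fieldType) (G1 G2 : orderedGroupType)
    (v1 : valuation F G1) (v2 : valuation F G2) x y :
  val_equiv v1 v2 -> (v1 x <i v1 y) = (v2 x <i v2 y).
Proof. by move=> h; rewrite !inf_ltNge h. Qed.

Lemma val_equiv_eq (F : fieldType) (G1 G2 : orderedGroupType)
    (v1 : valuation F G1) (v2 : valuation F G2) x y :
  val_equiv v1 v2 -> v1 x = v1 y -> v2 x = v2 y.
Proof.
by move=> h e; apply: inf_le_anti; rewrite -h e inf_lexx.
Qed.

Section ExtensionByRoot.
Variables (K : fieldType) (p : nat) (hp : p \in [pchar K]).
Variables (G : orderedGroupType) (v : valuation K G) (b : K) (gap : K -> K).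
Hypothesis gap_neg : forall c, v (gap c) <i v 1.
Hypothesis gap_approx :
  forall c, v (gap c ^+ p) <i v (b - wp p c - gap c ^+ p).
Variables (L : fieldExtType K) (G1 : orderedGroupType) (w : valuation L G1).
Hypothesis hw : val_equiv v (val_restr w).
Variable y : L.
Hypothesis hy : wp p y = b%:A.
Local Notation lift := (map_poly (in_alg L)).

Let hpL : p \in [pchar L]. Proof. by rewrite pchar_lalg. Qed.

Lemma val_root_gap c : w (y - c%:A) = w (gap c)%:A.
Proof.
apply: (val_wp_inj hpL).
  by have := gap_neg c; rewrite (val_equiv_lt _ _ hw) /= scale1r.
rewrite wpB // hy wp_in_alg -scalerBl -pow_in_alg.
exact: (val_equiv_eq hw (gapE gap_approx c)).
Qed.

(** This holds for every extension w of v, whence the uniqueness of w, and shows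
    that f.[y] is approximated by a scalar, whence immediacy. *)
Lemma dominant_root f c : dominant v gap f c ->
  w f.[c]%:A <i w ((lift f).[y] - f.[c]%:A).
Proof.
move=> fc; rewrite -!in_algE -horner_map; apply: (@val_dominant_taylor _ _ _ _ _ _ (gap c)%:A).
  move=> i i0; rewrite nderivn_map !horner_map /= -pow_in_alg.
  by have := fc i i0; rewrite (val_equiv_lt _ _ hw) /= -!in_algE rmorphM.
by rewrite /= val_root_gap inf_lexx.
Qed.

End ExtensionByRoot.

(** One and the same scalar a serves for all extensions of v: this gives both
    immediacy and the uniqueness of the extension. *)
Lemma scalar_approx (K : fieldType) (p : nat) (G : orderedGroupType)
    (v : valuation K G) (b : K) (L : fieldExtType K) (y : L) :
  p \in [pchar K] -> as_defect v p b -> \dim {:L} = p ->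
  wp p y = b%:A -> <<1; y>>%VS = fullv ->
  forall x : L, x != 0 -> exists a : K, forall (G1 : orderedGroupType)
    (w : valuation L G1), val_equiv v (val_restr w) ->
    w a%:A <i w (x - a%:A).
Proof.
move=> hp /choice[gap hgap] dimL hy gen x x0.
have gap1 c := (hgap c).1; have gap2 c := (hgap c).2.
have [f [sf ef]] := adjoin_poly_exists gen x.
have f0 : f != 0 by apply: contraNneq x0 => f0; rewrite ef f0 rmorph0 horner0.
have [|c fc] := near_ex (small_poly_dominant hp gap1 gap2 f0 _).
  by rewrite -dimL.
by exists f.[c] => G1 w hw; rewrite ef; apply: (dominant_root hp gap1 gap2 hw hy).
Qed.

Section ImmediateApprox.
Variables (K : fieldType) (L : splittingFieldType K) (G : orderedGroupType).
Variable w : valuation L G.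

Lemma immediate_approx : immediate w ->
  forall x : L, x != 0 -> exists a : K, w a%:A <i w (x - a%:A).
Proof.
move=> [hv hr] x x0; have [al xal] := val_fin w x0.
have [|c /= cal] := hv al; first by exists x.
have c0 : c%:A != 0 :> L by rewrite -(val_lt0 w) cal val_zero.
have xc : w (x / c%:A) = Some 0.
  by rewrite valuationM xal (valV_Some cal) /= subrr.
have rx : valuation_ring w (x / c%:A) by rewrite /valuation_ring /= xc /=.
have [|d _ ed] := hr (residue_class w (x / c%:A)); first by exists (x / c%:A).
have [_ hd] : residue_class w d%:A (x / c%:A).
  by rewrite -ed; split => //; rewrite subrr val_zero.
have wd : w d%:A = Some 0.
  by rewrite -xc; apply: val_close; rewrite xc val_subC.
exists (d * c); have -> : (d * c)%:A = d%:A * c%:A :> L.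
  by rewrite -in_algE rmorphM.
have -> : x - d%:A * c%:A = (x / c%:A - d%:A) * c%:A by rewrite mulrBl divfK.
by rewrite val_ltM2r // wd.
Qed.

Lemma approx_immediate :
  (forall x : L, x != 0 -> exists a : K, w a%:A <i w (x - a%:A)) -> immediate w.
Proof.
move=> h; split.
  move=> al [x xal]; have x0 : x != 0 by rewrite -(val_lt0 w) xal val_zero.
  have [a ha] := h x x0; exists a; rewrite /= -xal; apply/esym.
  exact: val_close ha.
move=> C [x]; rewrite /valuation_ring /= => rx ->.
have [->|x0] := eqVneq x 0; first by exists 0; rewrite /= scale0r ?val_zero.
have [a ha] := h x x0; have xa := val_close ha.
exists a; first by rewrite /= -xa.
apply/seteqP; split=> z [rz hz]; split=> //.
  have -> : z - a%:A = (z - x) + (x - a%:A) by rewrite addrA subrK.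
  rewrite -(val_one w); apply: val_ltD; rewrite val_one //.
  by apply: inf_le_lt_trans ha; rewrite -xa.
have -> : z - x = (z - a%:A) - (x - a%:A) by rewrite opprB addrA subrK.
rewrite -(val_one w); apply: val_ltB; rewrite val_one //.
by apply: inf_le_lt_trans ha; rewrite -xa.
Qed.

End ImmediateApprox.

(** * The set Sigma in terms of K *)

(** The values - v (y - c), for a root y of X^p - X - b. *)
Definition gap_values (K : fieldType) (G : orderedGroupType) (v : valuation K G)
    (p : nat) (b : K) : set G :=
  [set al | exists c e, [/\ v e <i v 1, v (b - wp p c) = v (e ^+ p)
                           & v e = Some (- al)]].

Section GapValues.
Variables (K : fieldType) (p : nat) (hp : p \in [pchar K]).
Variables (G : orderedGroupType) (v : valuation K G) (b : K).
Local Notation S := (gap_values v p b).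

Lemma gap_values_gt0 al : S al -> 0 < al.
Proof.
by move=> [c [e [e1 _ ea]]]; move: e1; rewrite ea val_one inf_lt_Some -og_ltN opprK oppr0.
Qed.

Lemma gap_values_sub : S `<=` value_group v.
Proof.
by move=> al [c [e [_ _ ea]]]; exists e^-1; rewrite (valV_Some ea) opprK.
Qed.

(** If v d > - v (gap c), then d^-1 is larger than gap c, and moving c by d^-1
    turns the gap into one of value - v d. *)
Lemma gap_values_final al be : S al -> value_group v be -> al <= be -> S be.
Proof.
move=> Sal [d db]; have [c [e [e1 ec ea]]] := Sal.
rewrite le_eqVlt => /orP[/eqP <- //|lt].
have dV := valV_Some db; have de : v d^-1 <i v e by rewrite dV ea inf_lt_Some og_ltN.
have d1 := inf_lt_trans de e1; exists (c + d^-1), d^-1; split => //.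
rewrite wpD // opprD addrA addrC -(val_wp_neg hp d1) val_addr val_opp //.
by rewrite (val_wp_neg hp d1) ec val_ltX // prime_gt0 // (pcharf_prime hp).
Qed.

Lemma gap_values_neq0 : as_defect v p b -> exists al, S al.
Proof.
move=> /(_ 0) [e [e1 ep]]; have [al ea] := val_fin v (val_lt_neq0 e1).
by exists (- al), 0, e; split=> //; [exact: val_close ep | rewrite opprK].
Qed.

End GapValues.


Section Sigma.
Variables (K : fieldType) (p : nat) (hp : p \in [pchar K]).
Variables (G : orderedGroupType) (v : valuation K G) (b : K).
Hypothesis hb : as_defect v p b.
Variables (L : splittingFieldType K) (w : valuation L G).
Hypothesis hw : forall a : K, w a%:A = v a.
Hypothesis galL : galois 1 {:L}.
Variable s : gal_of {:L}.
Hypothesis gen_s : generator 'Gal({:L} / 1) s.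
Variable y : L.
Hypothesis hy : wp p y = b%:A.

Let hpL : p \in [pchar L]. Proof. by rewrite pchar_lalg. Qed.

Lemma equiv_restr : val_equiv v (val_restr w).
Proof. by move=> a c; rewrite /= !hw. Qed.

Lemma gal_in_alg (a : K) : s a%:A = a%:A.
Proof. by rewrite linearZ /= rmorph1. Qed.

Lemma fixed_scalar (x : L) : s x = x -> exists a : K, x = a%:A.
Proof.
move=> sx; suff : x \in fixedField 'Gal({:L} / 1)%g.
  by rewrite (galois_fixedField galL) => /vlineP.
apply/fixedFieldP; first exact: memvf.
have /eqP -> := gen_s; move=> t /cycleP[n ->].
elim: n => [|n IH]; first by rewrite expg0 gal_id.
by rewrite expgSr galM ?memvf //= IH.
Qed.

(** The generator cannot fix y: a scalar y = c would have distance 0 from c,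
    while this distance is that of gap c. *)
Lemma gal_root_diff : s y - y != 0 /\ (s y - y) ^+ p = s y - y.
Proof.
split; last first.
  apply/eqP; rewrite -subr_eq0 -/(wp p _) wpB // {1}/wp -rmorphXn -rmorphB.
  by rewrite -/(wp p y) hy /= gal_in_alg subrr.
rewrite subr_eq0; apply/eqP => /fixed_scalar [c yc].
have /choice[gap hgap] := hb.
have := val_root_gap hp (fun c => (hgap c).1) (fun c => (hgap c).2) equiv_restr hy c.
rewrite yc subrr val_zero => /esym /val_eq_inf /eqP.
rewrite scaler_eq0 oner_eq0 orbF; apply/negP.
exact: gap_neq0 (fun c => (hgap c).1) c.
Qed.

Lemma gap_values_Sigma : gap_values v p b `<=` Sigma w s.
Proof.
move=> al [c [e [e1 ec ea]]]; have [u0 up] := gal_root_diff.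
have wy : w (y - c%:A) = Some (- al).
  rewrite -ea -hw; apply: (val_wp_inj hpL).
    by rewrite hw val_one -(val_one v).
  by rewrite wpB // hy wp_in_alg -scalerBl -pow_in_alg !hw.
exists (y - c%:A).
have -> : s (y - c%:A) - (y - c%:A) = s y - y.
  by rewrite rmorphB /= gal_in_alg opprB addrA subrK.
split.
- by rewrite -(val_lt0 w) wy val_zero.
- rewrite -subr_eq0 rmorphB /= gal_in_alg opprB addrA subrK //.
rewrite valuationM (valV_Some wy) (val_frob_fixed hpL w u0 up) val_one /=.
by rewrite opprK add0r.
Qed.

Hypothesis dimL : \dim {:L} = p.
Hypothesis gen_y : <<1; y>>%VS = fullv.

(** Write x = f.[y] and s y = y + u.  The terms of the Taylor expansion of
    s x - x = f.[y + u] - f.[y] are, up to factors u of value 0, the Taylor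
    coefficients of f at c, so by dominance (s x - x) / x has larger value than
    (gap c)^-1.  Since the gap values form a final segment, this is enough. *)
Lemma Sigma_gap_values : Sigma w s `<=` gap_values v p b.
Proof.
move=> al [x [x0 sx xal]]; have [u0 up] := gal_root_diff.
have wu := val_frob_fixed hpL w u0 up.
have /choice[gap hgap] := hb.
have gap1 c := (hgap c).1; have gap2 c := (hgap c).2.
have [f [sf ef]] := adjoin_poly_exists gen_y x; rewrite dimL in sf.
pose lift := map_poly (in_alg L).
have f0 : f != 0 by apply: contraNneq x0 => f0; rewrite ef f0 rmorph0 horner0.
have hnear (g : {poly K}) : near v gap (fun c => (size g <= p)%N -> w (lift g).[y] = w g.[c]%:A).
  have [->|g0] := eqVneq g 0.
    by apply: nearW => c _; rewrite /lift rmorph0 !horner0 scale0r.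
  case: (leqP (size g) p) => [sg|]; last by move=> ?; apply: nearW.
  apply: near_imp (small_poly_dominant hp gap1 gap2 g0 sg) => c gc _.
  exact/val_close/(dominant_root hp gap1 gap2 equiv_restr hy gc).
have snd i : (size f^`N(i) <= p)%N.
  apply: leq_trans sf; apply/leq_sizeP => j jf; rewrite coef_nderivn nth_default ?mul0rn //.
  by apply: leq_trans jf _; apply: leq_addl.
have [c [fc hc]] : exists c, dominant v gap f c /\
    forall i, (i < (size f).+1)%N -> w (lift f^`N(i)).[y] = w (f^`N(i)).[c]%:A.
  apply: (@near_ex _ _ v gap); apply: nearI.
    exact: (small_poly_dominant hp gap1 gap2 f0 sf).
  apply: near_all => i _; apply: near_imp (hnear f^`N(i)) => c; apply; exact: snd.
have wx : w x = v f.[c].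
  by rewrite ef -hw -/lift; have := hc 0%N isT; rewrite nderivn0.
have hs : w x <i w ((gap c)%:A * (s x - x)).
  have -> : s x - x = \sum_(i < size f) (lift f^`N(i.+1)).[y] * (s y - y) ^+ i.+1.
    have -> : s x = (lift f).[s y].
      rewrite ef -horner_map /= -map_poly_comp; congr (_.[_]).
      by apply: eq_map_poly => a /=; rewrite gal_in_alg.
    rewrite (taylor_shift _ _ y) /lift size_map_poly -ef addrAC subrr add0r.
    by apply: eq_bigr => i _; rewrite nderivn_map.
  rewrite mulr_sumr; apply: val_lt_sum => // i _.
  have -> : w ((gap c)%:A * ((lift f^`N(i.+1)).[y] * (s y - y) ^+ i.+1)) =
            v (gap c * f^`N(i.+1).[c]).
    rewrite -hw -[in RHS]in_algE rmorphM /=; apply: val_eqM => //.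
    rewrite -[RHS]/(w f^`N(i.+1).[c]%:A) -[f^`N(i.+1).[c]%:A]mulr1; apply: val_eqM.
      by apply: hc; rewrite ltnS.
    by rewrite (val_eqX _ wu) expr1n.
  rewrite wx; apply: inf_lt_le_trans (fc i.+1 isT) _.
  rewrite mulrC; apply: val_leM; rewrite ?inf_lexx //.
  case: (i : nat) => [|j]; first by rewrite expr1 inf_lexx.
  by apply/inf_ltW/val_ltX_self.
pose q := (s x - x) / x.
have q0 : q != 0 by rewrite -(val_lt0 w) -/q xal val_zero.
have [d hd] := scalar_approx hp hb dimL hy gen_y q0.
have vd : v d = Some al.
  by rewrite -hw -xal; apply/esym/val_close/(hd _ w equiv_restr).
have h1 : v 1 <i v (gap c * d).
  rewrite -!hw scale1r -(val_ltM2r w _ _ x0) mul1r -[(gap c * d)%:A]in_algE rmorphM /=.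
  apply: inf_lt_le_trans hs _.
  have -> : s x - x = q * x by rewrite divfK.
  rewrite mulrA !val_leM2r //; apply: val_leM; rewrite ?inf_lexx //.
  by rewrite hw vd xal inf_lexx.
have [ga eg] := val_fin v (gap_neq0 gap1 c).
apply: (@gap_values_final _ _ hp _ _ _ (- ga)).
- exists c, (gap c); split; [exact: gap1 | exact: gapE gap2 c | by rewrite opprK].
- by exists d.
move: h1; rewrite val_one valuationM eg vd /= inf_lt_Some => /ltW.
by rewrite -[- ga <= al](og_ler2l ga) subrr.
Qed.

Lemma Sigma_eq : Sigma w s = gap_values v p b.
Proof.
by apply/seteqP; split; [exact: Sigma_gap_values | exact: gap_values_Sigma].
Qed.

End Sigma.

(** * Every such constant b gives a Galois defect extension *)
Section RootExtension.
Variables (K : fieldType) (p : nat) (hp : p \in [pchar K]) (b : K).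
Variables (L : fieldExtType K) (y : L).
Hypothesis hy : wp p y = b%:A.
Hypothesis gen_y : <<1; y>>%VS = fullv.

Let hpL : p \in [pchar L]. Proof. by rewrite pchar_lalg. Qed.
Let p_gt0 : (0 < p)%N. Proof. exact/prime_gt0/(pcharf_prime hp). Qed.

Lemma wp_natr i : wp p i%:R = 0 :> L.
Proof. by rewrite /wp -(pFrobenius_autE hpL) pFrobenius_aut_nat subrr. Qed.

Lemma natr_lt_inj i j : (i < p)%N -> (j < p)%N -> i%:R = j%:R :> L -> i = j.
Proof.
move=> ip jp e; wlog ij : i j ip jp e / (i <= j)%N.
  by move=> H; case/orP: (leq_total i j) => h; [|symmetry]; apply: H.
apply/eqP; rewrite eqn_leq ij -subn_eq0 /=.
have : (p %| j - i)%N by rewrite (dvdn_pcharf hpL) natrB // e subrr.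
by apply: contraTT => h; rewrite gtnNdvd ?lt0n // (leq_ltn_trans (leq_subr _ _)).
Qed.

(** The roots are the translates of y by the elements of the prime field. *)
Lemma wp_splitting : exists q : {poly L},
  [/\ q \is a polyOver 1%VS, separable_poly q & splittingFieldFor 1 q {:L}].
Proof.
pose rs := [seq y + i%:R | i <- iota 0 p].
pose q := map_poly (in_alg L) (wp_poly p b).
have uq : uniq rs.
  rewrite map_inj_in_uniq ?iota_uniq // => i j.
  by rewrite !mem_iota !add0n /= => ip jp /addrI; apply: natr_lt_inj.
have qE : q = \prod_(z <- rs) ('X - z%:P).
  have lead1 : lead_coef q = 1.
    rewrite /q lead_coef_map /= lead_coefE size_wp_poly //= /wp_poly.
    rewrite !coefB coefXn eqxx coefX coefC (gtn_eqF (prime_gt1 (pcharf_prime hp))).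
    by rewrite (gtn_eqF p_gt0) !subr0 scale1r.
  rewrite -[RHS]scale1r -[in RHS]lead1; apply: all_roots_prod_XsubC.
  - by rewrite size_map_poly size_wp_poly // size_map size_iota.
  - apply/allP => z /mapP[i _ ->]; rewrite /root /q /wp_poly.
    rewrite !rmorphB /= map_polyXn map_polyX map_polyC !hornerE /=.
    by rewrite -/(wp p _) wpD // hy wp_natr addr0 subrr.
  - by rewrite uniq_rootsE.
exists q; split.
- by apply/polyOver1P; exists (wp_poly p b).
- by rewrite qE separable_prod_XsubC.
exists rs; first by rewrite qE eqpxx.
apply/eqP; rewrite eqEsubv subvf /= -[X in (X <= _)%VS]gen_y.
apply/FadjoinP; split; first exact: subv_adjoin_seq.
apply: seqv_sub_adjoin; apply/mapP; exists 0%N; last by rewrite addr0.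
by rewrite mem_iota /= add0n.
Qed.

Variables (G : orderedGroupType) (v : valuation K G).
Hypothesis hb : as_defect v p b.
Hypothesis dimL : \dim {:L} = p.

(** The value of f.[y], for f of degree less than p, is the eventual value of
    f.[c].  Only multiplicativity is not immediate.  A product of
    representatives differs from the representative of the product by a
    multiple q * wp_poly with deg q < p, whose value at c increases strictly; as
    the values of the other two terms are eventually constant, they are equal. *)
Lemma eventual_valuation : exists w : valuation L G, forall a : K, w a%:A = v a.
Proof.
have /choice[gap hgap] := hb.
have gap1 c := (hgap c).1; have gap2 c := (hgap c).2.
pose lift := map_poly (in_alg L).
have dom (f : {poly K}) := @small_poly_dominant _ _ hp _ _ _ _ gap1 gap2 f.
have rep x : exists fa : {poly K} * K, [/\ (size fa.1 <= p)%N, x = (lift fa.1).[y],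
    (fa.2 == 0) = (x == 0) & near v gap (fun c => v fa.1.[c] = v fa.2)].
  have [f [sf ef]] := adjoin_poly_exists gen_y x; rewrite dimL in sf.
  have [f0|f0] := eqVneq f 0.
    exists (0, 0); rewrite ef f0 /lift /= rmorph0 horner0 size_poly0 !eqxx; split => //.
    by apply: nearW => c; rewrite horner0.
  have [a a0 ha] := near_dominant_val hp gap1 gap2 (dom f f0 sf).
  exists (f, a); split => //=; rewrite (negPf a0); apply/esym/eqP => x0.
  move/eqP: f0; apply; apply: (adjoin_poly_root gen_y); rewrite ?dimL //.
  by rewrite -ef x0.
case/choice: rep => fa hfa; pose f x := (fa x).1; pose A x := (fa x).2.
have sf x : (size (f x) <= p)%N by case: (hfa x).
have ef x : x = (lift (f x)).[y] by case: (hfa x).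
have A0 x : (A x == 0) = (x == 0) by case: (hfa x).
have hA x : near v gap (fun c => v (f x).[c] = v (A x)) by case: (hfa x).
have funiq x (g : {poly K}) : (size g <= p)%N -> (lift g).[y] = x -> f x = g.
  move=> sg eg; apply/eqP; rewrite -subr_eq0; apply/eqP.
  apply: (adjoin_poly_root gen_y).
    by rewrite dimL (leq_trans (size_polyD _ _)) // size_polyN geq_max sf.
  by rewrite rmorphB /= hornerD hornerN -ef eg subrr.
have wM x z : v (A (x * z)) = inf_add (v (A x)) (v (A z)).
  rewrite -valuationM; apply: contrapT => ne.
  pose P := wp_poly p b; pose g := f x * f z.
  have P0 : P != 0 by apply: wp_poly_neq0 hp b.
  have fxz : f (x * z) = g %% P.
    apply: funiq; first by rewrite -ltnS -(size_wp_poly hp b) ltn_modp.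
    have : (lift g).[y] = x * z by rewrite /lift rmorphM /= hornerM -!ef.
    rewrite {1}(divp_eq g P) /lift rmorphD rmorphM /= hornerD hornerM.
    suff -> : (map_poly (in_alg L) P).[y] = 0 by rewrite mulr0 add0r.
    rewrite /P /wp_poly !rmorphB /= map_polyXn map_polyX map_polyC !hornerE /=.
    by rewrite -/(wp p _) hy subrr.
  have [m m0 hm] : exists2 m, m != 0 & near v gap (fun c => v ((g %/ P).[c] * gap c ^+ p) = v m).
    have hg : near v gap (fun c => v g.[c] = v (A x * A z)).
      by apply: near_imp (nearI (hA x) (hA z)) => c [e1 e2]; rewrite hornerM; apply: val_eqM.
    have qP c : v ((g %/ P).[c] * gap c ^+ p) = v (g.[c] - (f (x * z)).[c]).
      rewrite fxz {2}(divp_eq g P) hornerD addrK hornerM; apply: val_eqM => //.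
      by rewrite -(val_wp_poly gap2).
    case: (inf_lt_total ne) => lt; have := val_lt_neq0 lt => m0.
      exists (A (x * z)) => //; apply: near_imp (nearI hg (hA (x * z))) => c [e1 e2].
      by rewrite qP val_subC val_addr // val_opp e1 e2.
    exists (A x * A z) => //; apply: near_imp (nearI hg (hA (x * z))) => c [e1 e2].
    by rewrite qP val_addr // val_opp e1 e2.
  have q0 : g %/ P != 0.
    apply/eqP => q0; have [c] := near_ex hm; rewrite q0 horner0 mul0r val_zero.
    by move/esym/val_eq_inf/eqP; rewrite (negPf m0).
  have sq : (size (g %/ P)%R <= p)%N.
    rewrite size_divp // size_wp_poly //= leq_subLR.
    apply: leq_trans (size_polyMleq _ _) _; apply: leq_trans (leq_pred _) _.
    exact: leq_add.
  have [d d0 hd] := near_dominant_val hp gap1 gap2 (dom _ q0 sq).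
  apply: (gap_not_eventually_const hp gap1 gap2 (a := m / d) p_gt0).
  apply: near_imp (nearI hm hd) => c [e1 e2].
  have -> : gap c ^+ p = d * gap c ^+ p / d by rewrite mulrAC mulfV // mul1r.
  by apply: val_eqM => //; rewrite -e1; apply: val_eqM.
have wD x z : inf_le (inf_min (v (A x)) (v (A z))) (v (A (x + z))).
  have fxz : f (x + z) = f x + f z.
    apply: funiq; first by rewrite (leq_trans (size_polyD _ _)) // geq_max !sf.
    by rewrite /lift rmorphD hornerD -!ef.
  have [c [e [e1 e2]]] := near_ex (nearI (hA (x + z)) (nearI (hA x) (hA z))).
  by rewrite -e -e1 -e2 fxz hornerD; apply: valuationD.
have w0 x : v (A x) = None <-> x = 0.
  by rewrite val_eq_inf; split=> /eqP; [rewrite A0 | rewrite -A0] => /eqP.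
exists (Valuation w0 wM wD) => a /=.
have fa0 : f a%:A = a%:P.
  apply: funiq; last by rewrite /lift map_polyC hornerC.
  exact: leq_trans (size_polyC_leq1 _) p_gt0.
by have [c] := near_ex (hA a%:A); rewrite fa0 hornerC.
Qed.

End RootExtension.

Lemma artin_schreier_extension (K : fieldType) (p : nat) (G : orderedGroupType)
    (v : valuation K G) (b : K) : p \in [pchar K] -> as_defect v p b ->
  exists (L : splittingFieldType K) (w : valuation L G) (y : L),
  [/\ forall a : K, w a%:A = v a, galois_defect w p, wp p y = b%:A
    & <<1; y>>%VS = fullv].
Proof.
move=> hp hb; have /choice[gap hgap] := hb.
have gap1 c := (hgap c).1; have gap2 c := (hgap c).2.
have [L0 dimL [y rooty gen]] := irredp_FAdjoin (wp_poly_irr hp gap1 gap2).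
rewrite size_wp_poly //= in dimL.
have hy : wp p y = b%:A.
  apply/eqP; move: rooty; rewrite /root /wp_poly !rmorphB /= map_polyXn map_polyX map_polyC.
  by rewrite !hornerE /= subr_eq0.
have [q [qK sepq splq]] := wp_splitting hp hy gen.
have ax : SplittingField.axiom L0 by exists q.
pose m := FieldExt_isSplittingField.Build K L0 ax.
pose L : splittingFieldType K := HB.pack_for (splittingFieldType K) (FieldExt.sort L0) L0 m.
have [w hw] := @eventual_valuation K p hp b L y hy gen G v hb dimL.
have approx := @scalar_approx K p G v b L y hp hb dimL hy gen.
have ew : val_equiv v (val_restr w) by move=> a c; rewrite /= !hw.
exists L, w, y; split => //; split => //.
- by apply/splitting_galoisField; exists q.
- by apply: approx_immediate => x /approx[a ha]; exists a; apply: ha.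
move=> G1 w1 ew1; have ev1 : val_equiv v (val_restr w1).
  by move=> a c; rewrite ew ew1.
have rep x : exists a : K, w x = w a%:A /\ w1 x = w1 a%:A.
  have [->|x0] := eqVneq x 0; first by exists 0; rewrite scale0r.
  by have [a ha] := approx x x0; exists a; split; apply/val_close/ha.
move=> x z; have [a [-> ->]] := rep x; have [c [-> ->]] := rep z; exact: ew1.
Qed.

(** * Galois defect extensions are generated by such roots *)
Section ArtinSchreierGenerator.
Variables (K : fieldType) (p : nat) (hp : p \in [pchar K]).
Variables (L : splittingFieldType K).
Hypothesis galL : galois 1 {:L}.
Hypothesis dimL : \dim {:L} = p.

Let hpL : p \in [pchar L]. Proof. by rewrite pchar_lalg. Qed.
Let p_prime : prime p. Proof. exact: pcharf_prime hp. Qed.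
Let p_gt0 : (0 < p)%N. Proof. exact: prime_gt0. Qed.

Lemma card_gal_p : #|'Gal({:L} / 1)%g| = p.
Proof. by rewrite -galois_dim // dimL dimv1 divn1. Qed.

Lemma gal_generator : exists s : gal_of {:L}, generator 'Gal({:L} / 1) s.
Proof.
have /cyclicP[s es] : cyclic 'Gal({:L} / 1)%g.
  by apply: prime_cyclic; rewrite card_gal_p.
by exists s; rewrite /generator es.
Qed.

Lemma adjoin_prime_dim (y : L) : y \notin 1%VS -> <<1; y>>%VS = fullv.
Proof.
move=> y1; apply/eqP; rewrite eqEdim subvf /= dimL.
have : (\dim <<1; y>> %| p)%N by rewrite -dimL; apply: field_dimS; apply: subvf.
move/(primeP p_prime).2 => /orP[/eqP d1|/eqP -> //].
case/negP: y1; have -> : 1%VS = <<1; y>>%VS.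
  by apply/eqP; rewrite eqEdim subv_adjoin d1 dimv1.
exact: memv_adjoin.
Qed.

Variable s : gal_of {:L}.
Hypothesis gen_s : generator 'Gal({:L} / 1) s.

(** Additive Hilbert 90 in the case needed: with a of nonzero trace T, the
    element - (sum of j s^j(a)) / T is moved by 1. *)
Lemma gal_shift : exists y : L, s y = y + 1.
Proof.
have /eqP es := gen_s.
have os : #[s]%g = p by rewrite /order -es card_gal_p.
have [a _ ta] := @gal_independent_contra _ _ {:L} [in 'Gal({:L} / 1)%g]
  (fun=> 1) 1%g (group1 _) (oner_neq0 L).
pose u j : L := (s ^+ j)%g a.
have uS j : s (u j) = u j.+1 by rewrite /u expgSr galM ?memvf.
pose T := \sum_(j < p) u j.
have T0 : T != 0.
  suff -> : T = \sum_(t in 'Gal({:L} / 1)%g) 1 * t a by [].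
  rewrite es /T -os; have -> : <[s]>%g = [set (s ^+ (j : nat))%g | j : 'I_#[s]%g]%SET.
    apply/setP => t; apply/idP/imsetP => [/cyclePmin[j jo ->]|[j _ ->]].
      by exists (Ordinal jo).
    exact: mem_cycle.
  rewrite big_imset /=; first by apply: eq_bigr => j _; rewrite mul1r.
  move=> i j _ _ /eqP; rewrite eq_expg_mod_order !modn_small ?ltn_ord // => /eqP.
  exact: val_inj.
have sT : s T = T.
  rewrite /T rmorph_sum /=; under eq_bigr => j _ do rewrite uS.
  rewrite -(prednK p_gt0) big_ord_recr [RHS]big_ord_recl /= addrC.
  congr (_ + _).
  by rewrite prednK // /u -os expg_order expg0.
pose U := \sum_(j < p) u j *+ j.
have sU : s U + T = U.
  rewrite -{1}sT /U /T !rmorph_sum -big_split /=.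
  under eq_bigr => j _ do rewrite rmorphMn /= uS -mulrSr.
  transitivity (\sum_(j < p.+1) u j *+ j); first by rewrite big_ord_recl mulr0n add0r.
  by rewrite big_ord_recr /= -(mulr_natr (u p)) (pcharf0 hpL) mulr0 addr0.
exists (- U / T); rewrite rmorphM rmorphN fmorphV /= sT.
have -> : s U = U - T by rewrite -sU addrK sU.
by rewrite opprB mulrBl mulfV // addrC mulNr.
Qed.

Lemma artin_schreier_generator : exists (b : K) (y : L),
  wp p y = b%:A /\ <<1; y>>%VS = fullv.
Proof.
have [y sy] := gal_shift.
have [|b yb] := fixed_scalar galL gen_s (x := wp p y).
  rewrite /wp rmorphB rmorphXn /= -/(wp p _) sy -/(wp p _) wpD //.
  by rewrite {2}/wp expr1n subrr addr0.
exists b, y; split=> //; apply: adjoin_prime_dim; apply/negP => /vlineP[c yc].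
have := sy; rewrite yc gal_in_alg => /eqP.
by rewrite -subr_eq0 opprD addNKr oppr_eq0 oner_eq0.
Qed.

End ArtinSchreierGenerator.

Section OriginalDefect.
Variables (K : fieldType) (p : nat) (hp : p \in [pchar K]).
Variables (L : splittingFieldType K) (G : orderedGroupType) (w : valuation L G).
Hypothesis defL : galois_defect w p.

(** The valuation w o s extends the restriction of w to K, so it is equivalent
    to w; comparing x with a scalar of the same value turns this into an
    equality of values. *)
Lemma val_gal (s : gal_of {:L}) x : w (s x) = w x.
Proof.
have [_ _ imm uni] := defL.
have w0 z : w (s z) = None <-> z = 0.
  by rewrite val_eq_inf; split=> [/eqP|->]; rewrite ?rmorph0 ?fmorph_eq0 // => /eqP.
have wM z t : w (s (z * t)) = inf_add (w (s z)) (w (s t)).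
  by rewrite rmorphM valuationM.
have wD z t : inf_le (inf_min (w (s z)) (w (s t))) (w (s (z + t))).
  by rewrite rmorphD; apply: valuationD.
have eq_ws : val_equiv w (Valuation w0 wM wD).
  by apply: uni => a c; rewrite /= !gal_in_alg.
have [->|x0] := eqVneq x 0; first by rewrite rmorph0.
have [a ha] := immediate_approx imm x0; have xa := val_close ha.
by have /= := val_equiv_eq eq_ws xa; rewrite gal_in_alg -xa.
Qed.

(** All y - a, for a in K, have value at most 0, since otherwise their conjugates
    would have the value 0 of u = s y - y.  By immediacy the value is then
    negative: if it were 0, one could choose a better a. *)
Lemma galois_defect_as_defect (b : K) (y : L) :
  wp p y = b%:A -> <<1; y>>%VS = fullv -> as_defect (val_restr w) p b.
Proof.
move=> hy gen c; have [galL dimL imm _] := defL.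
have [s gen_s] := gal_generator hp galL dimL.
have hpL : p \in [pchar L] by rewrite pchar_lalg.
pose u := s y - y.
have u0 : u != 0.
  apply/eqP => /eqP; rewrite subr_eq0 => /eqP /(fixed_scalar galL gen_s) [a ya].
  have y1 : y \in 1%VS by apply/vlineP; exists a.
  move/Fadjoin_idP: y1; rewrite gen => L1.
  have := prime_gt1 (pcharf_prime hp).
  by rewrite -dimL L1 dimv1.
have up : u ^+ p = u.
  apply/eqP; rewrite -subr_eq0 -/(wp p _) wpB // {1}/wp -rmorphXn -rmorphB.
  by rewrite -/(wp p y) hy /= gal_in_alg subrr.
have wu : w u = w 1 := val_frob_fixed hpL w u0 up.
have small a : w (y - a%:A) <=i w 1.
  rewrite inf_leNgt; apply/negP => h.
  have := val_gal s (y - a%:A); rewrite rmorphB /= gal_in_alg.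
  have -> : s y - a%:A = u + (y - a%:A) by rewrite /u addrA subrK.
  by rewrite val_addr wu // => e; move: h; rewrite e inf_ltxx.
pose x := y - c%:A.
have x0 : x != 0.
  by apply: contraTneq (small c) => x0; rewrite -/x x0 val_zero val_one.
have [e he] := immediate_approx imm x0; have xe := val_close he.
have x1 : w x <i w 1.
  rewrite inf_ltNge; apply/negP => h; have := small (c + e).
  rewrite scalerDl opprD addrA -/x inf_leNgt => /negP; apply.
  by apply: inf_le_lt_trans he; rewrite -xe.
have p1 := prime_gt1 (pcharf_prime hp).
exists e; split; first by rewrite /= scale1r -xe.
rewrite /= pow_in_alg.
have -> : (b - wp p c - e ^+ p)%:A = (x - e%:A) ^+ p - x.
  rewrite 2!scalerBl -hy -wp_in_alg -wpB // pow_in_alg -/x /wp.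
  by rewrite -!(pFrobenius_autE hpL) (rmorphB _ x) /= addrAC.
apply: val_ltB; first by rewrite val_ltX // ltnW.
by rewrite xe; apply: val_ltX_self; rewrite // -xe.
Qed.

End OriginalDefect.

Section Independence.
Variables (K : fieldType) (p : nat) (hp : p \in [pchar K]).
Variables (G : orderedGroupType) (v : valuation K G) (b : K).
Hypothesis hb : as_defect v p b.
Local Notation S := (gap_values v p b).

(** * Dependent defect *)

(** This is independence of the defect, expressed in K. *)
Definition gaps_above_subgroup : Prop := exists H : set G,
  [/\ convex_subgroup (value_group v) H, H <> value_group v
    & S = above (value_group v) H].

Lemma independent_defectP (L : splittingFieldType K) (w : valuation L G) (y : L) :
  (forall a : K, w a%:A = v a) -> galois_defect w p ->
  wp p y = b%:A -> <<1; y>>%VS = fullv ->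
  independent_defect w <-> gaps_above_subgroup.
Proof.
move=> hw [galL dimL _ _] hy gen.
have vg : value_group (val_restr w) = value_group v.
  by apply/seteqP; split=> al [a /= e]; exists a; move: e; rewrite /= hw.
split=> [[s [H [gs cH nH e]]]|[H [cH nH e]]].
  by exists H; rewrite -vg -(Sigma_eq hp hb hw galL gs hy dimL gen).
have [s gs] := gal_generator hp galL dimL.
by exists s, H; rewrite vg (Sigma_eq hp hb hw galL gs hy dimL gen).
Qed.

Lemma value_group0 : value_group v 0.
Proof. by exists 1; rewrite val_one. Qed.

Lemma value_groupB al be : value_group v al -> value_group v be ->
  value_group v (al - be).
Proof.
by move=> [x xal] [z zbe]; exists (x / z); rewrite valuationM xal (valV_Some zbe).
Qed.

(** If every al in S is at least p be >= be + be for some be in S, the elements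
    of the value group smaller in absolute value than all of S are closed under
    subtraction; S lies above the subgroup they form, and it contains every
    element above it because S is a final segment. *)
Lemma exists_small_gap : ~ gaps_above_subgroup ->
  exists2 al, S al & forall be, S be -> al < be *+ p.
Proof.
move=> nI; apply: contrapT => nal; apply: nI.
have half al : S al -> exists2 be, S be & be *+ p <= al.
  move=> Sal; apply: contrapT => h; apply: nal; exists al => // be Sbe.
  by rewrite og_ltNge; apply/negP => le; apply: h; exists be.
have [al0 Sal0] := gap_values_neq0 hb.
pose H : set G := [set g | value_group v g /\ forall be, S be -> g < be /\ - g < be].
exists H; split.
- split=> [g [] //|||].
  + by split; [exact: value_group0|move=> be /gap_values_gt0 be0; rewrite oppr0].
  + move=> a c [va ha] [vc hc]; split; first exact: value_groupB.
    move=> be /half [ga Sga]; have ga0 := gap_values_gt0 Sga.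
    have le2 : ga + ga <= ga *+ p.
      have := prime_gt1 (pcharf_prime hp); case: (p) => [|[|n]] // _.
      rewrite !mulrS addrA -[X in X <= _]addr0 og_ler2l.
      by have := og_le_mulrn n (ltW ga0); rewrite mul0rn.
    move=> le; have [a1 a2] := ha _ Sga; have [c1 c2] := hc _ Sga.
    split; apply: lt_le_trans (le_trans le2 le).
      by apply: og_ltleD (ltW _).
    by rewrite opprB addrC; apply: og_ltleD (ltW _).
  + move=> a g c [_ ha] [_ hc] vg ag gc; split=> // be Sbe; split.
      by apply: le_lt_trans gc _; case: (hc be Sbe).
    by apply: le_lt_trans (_ : - g <= - a) _; [rewrite og_leN | case: (ha be Sbe)].
- move=> e; have : H al0 by rewrite e; apply: gap_values_sub Sal0.
  by case=> _ /(_ _ Sal0) []; rewrite ltxx.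
apply/seteqP; split=> [be Sbe|be [vbe hbe]].
  by split; [exact: gap_values_sub Sbe | move=> g [_ /(_ _ Sbe) []]].
have be0 : 0 < be.
  by apply: hbe; split; [exact: value_group0|move=> ga /gap_values_gt0 ga0; rewrite oppr0].
apply: contrapT => nS; have Hbe : H be.
  split=> // ga Sga; have lt : be < ga.
    by rewrite og_ltNge; apply/negP => /(gap_values_final hp Sga vbe).
  split=> //; apply: lt_trans (gap_values_gt0 Sga).
  by rewrite -oppr0 og_ltN.
by have := hbe be Hbe; rewrite ltxx.
Qed.

End Independence.

Section Scaling.
Variables (K : fieldType) (p : nat) (hp : p \in [pchar K]).
Variables (G : orderedGroupType) (v : valuation K G) (b : K).
Hypothesis hb : as_defect v p b.

Let p_gt1 : (1 < p)%N. Proof. exact/prime_gt1/(pcharf_prime hp). Qed.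
Let p_gt0 : (0 < p)%N. Proof. exact: ltnW. Qed.

Lemma as_defect_translate c0 : as_defect v p (b - wp p c0).
Proof.
by move=> c; have [e] := hb (c0 + c); rewrite wpD // opprD addrA => he; exists e.
Qed.

Lemma gap_values_translate c0 : gap_values v p (b - wp p c0) = gap_values v p b.
Proof.
apply/seteqP; split=> al [c [e]].
  by move=> h; exists (c0 + c), e; rewrite wpD // opprD addrA.
have -> : c = c0 + (c - c0) by rewrite addrC subrK.
by rewrite wpD // opprD addrA => h; exists (c - c0), e.
Qed.

Hypothesis center_close : forall c e, v e <i v 1 ->
  v (b - wp p c) = v (e ^+ p) -> v (e ^+ p) <i v c.
Variable d : K.
Hypotheses (d0 : d != 0) (d1 : v d <=i v 1).

(** The two sides of X^p - X = d^p b at X = d y differ by (d^p - d) y; here y is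
    replaced by its approximation c, whose value [center_close] compares with the
    gap. *)
Lemma scaled_gap c e : v e <i v 1 -> v (e ^+ p) <i v (b - wp p c - e ^+ p) ->
  v ((d * e) ^+ p) <i v (d ^+ p * b - wp p (d * c) - (d * e) ^+ p).
Proof.
move=> e1 he; have hc := center_close e1 (val_close he).
have -> : d ^+ p * b - wp p (d * c) - (d * e) ^+ p =
    d ^+ p * (b - wp p c - e ^+ p) + (d - d ^+ p) * c.
  by rewrite /wp !exprMn; ring.
have D0 : d ^+ p != 0 by rewrite expf_neq0.
have dp : v (d ^+ p) <=i v d.
  rewrite -[X in _ <=i v X]mulr1 -[in d ^+ p](prednK p_gt0) exprS val_leM2l //.
  by rewrite -(expr1n _ p.-1) val_leX.
rewrite exprMn; apply: val_ltD; first by rewrite val_ltM2l.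
apply: inf_lt_le_trans (_ : v (d ^+ p * c) <=i _); first by rewrite val_ltM2l.
by apply: val_leM; rewrite ?inf_lexx // val_leB ?inf_lexx.
Qed.

Lemma scaled_neg e : v e <i v 1 -> v (d * e) <i v 1.
Proof.
by move=> e1; rewrite mulrC -[1]mulr1; apply: val_ltM.
Qed.

Lemma as_defect_scale : as_defect v p (d ^+ p * b).
Proof.
move=> c; have [e [e1 he]] := hb (c / d); exists (d * e); split; first exact: scaled_neg.
by have := scaled_gap e1 he; rewrite mulrCA mulfV // mulr1.
Qed.

Lemma gap_values_scale de al : v d = Some de ->
  gap_values v p (d ^+ p * b) al <-> gap_values v p b (al + de).
Proof.
move=> dde; split=> [[c [e' [e'1 e'c e'al]]]|[c [e' [e'1 e'c e'al]]]].
  have [e [e1 he]] := hb (c / d); have := val_close (scaled_gap e1 he).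
  rewrite mulrCA mulfV // mulr1 e'c => /(val_eqXE p_gt0); rewrite e'al => E.
  have [ep epe] := val_fin v (val_lt_neq0 e1).
  exists (c / d), e; split=> //; first exact: val_close he.
  move: E; rewrite valuationM dde epe /= => -[E'].
  by rewrite opprD E' addrAC addrN add0r.
have [e [e1 he]] := hb c; have ee' : v e = v e'.
  by apply: (val_eqXE p_gt0); rewrite -(val_close he).
exists (d * c), (d * e); split; first exact: scaled_neg.
  exact: val_close (scaled_gap e1 he).
by rewrite valuationM dde ee' e'al /= opprD addrCA addrN addr0.
Qed.

End Scaling.

Lemma og_mulrn_le (G : orderedGroupType) (x : G) m n :
  0 <= x -> (m <= n)%N -> x *+ m <= x *+ n.
Proof.
move=> x0 mn; rewrite -(subnK mn) mulrnDr -[X in X <= _]add0r og_ler2r.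
by have := og_le_mulrn (n - m) x0; rewrite mul0rn.
Qed.

(** * The family of extensions *)
Section Family.
Variables (K : fieldType) (p : nat) (hp : p \in [pchar K]).
Variables (G : orderedGroupType) (v : valuation K G) (b : K) (al : G).
Hypothesis al_gap : gap_values v p b al.
Variable b_ : nat -> K.
Hypothesis gap_values_b_ : forall n be,
  gap_values v p (b_ n) be <-> gap_values v p b (be - al *+ n.+1).

Let al_gt0 : 0 < al. Proof. exact: gap_values_gt0 al_gap. Qed.

Lemma family_gap_mem n : gap_values v p (b_ n) (al *+ n.+2).
Proof. by apply/gap_values_b_; rewrite mulrSr addrAC subrr add0r. Qed.

Lemma family_gap_notin m n : (m <= n)%N -> ~ gap_values v p (b_ n) (al *+ m.+1).
Proof.
move=> mn /gap_values_b_ /gap_values_gt0; apply/negP; rewrite -og_leNgt.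
by rewrite -(og_ler2r (al *+ n.+1)) subrK add0r og_mulrn_le // ltW.
Qed.

(** The element al is not in the shifted set, so it is in H, and so are its
    multiples; but one of them is a gap value. *)
Lemma family_not_above n : ~ gaps_above_subgroup p v (b_ n).
Proof.
move=> [H [[_ H0 Hsub Hconv] _ e]].
have valg : value_group v al := gap_values_sub al_gap.
have Hal : H al.
  apply: contrapT => nH; apply: (@family_gap_notin 0 n) => //; rewrite e mulr1n.
  split=> // h Hh; rewrite og_ltNge; apply/negP => le; apply: nH.
  by apply: (Hconv 0 al h) => //; apply: ltW.
have Hmul k : H (al *+ k).
  elim: k => [|k IH]; first by rewrite mulr0n.
  have -> : al *+ k.+1 = al *+ k - (0 - al) by rewrite sub0r opprK mulrSr.
  by apply: (Hsub) => //; apply: (Hsub).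
have := family_gap_mem n; rewrite e => -[_ /(_ _ (Hmul n.+2))].
by rewrite ltxx.
Qed.

Lemma family_distinct m n : m <> n ->
  (exists be, gap_values v p (b_ m) be /\ ~ gap_values v p (b_ n) be) \/
  (exists be, gap_values v p (b_ n) be /\ ~ gap_values v p (b_ m) be).
Proof.
move/eqP; rewrite neq_ltn => /orP[mn|nm]; [left|right].
  by exists (al *+ m.+2); split; [exact: family_gap_mem | exact: family_gap_notin].
by exists (al *+ n.+2); split; [exact: family_gap_mem | exact: family_gap_notin].
Qed.

End Family.

(** The constants are b_n = t^(p (n + 1)) (b - wp c0), where c0 is an
    approximation with gap value al and v t = - al. *)
Lemma dependent_defect_family (K : fieldType) (p : nat) (G : orderedGroupType)
    (v : valuation K G) (b : K) :
  p \in [pchar K] -> as_defect v p b -> ~ gaps_above_subgroup p v b ->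
  exists b_ : nat -> K, [/\ forall n, as_defect v p (b_ n),
    forall n, ~ gaps_above_subgroup p v (b_ n) &
    forall m n, m <> n ->
      (exists be, gap_values v p (b_ m) be /\ ~ gap_values v p (b_ n) be) \/
      (exists be, gap_values v p (b_ n) be /\ ~ gap_values v p (b_ m) be)].
Proof.
move=> hp hb nI; have [al Sal al_min] := exists_small_gap hp hb nI.
have [c0 [t [t1 tc tal]]] := Sal.
pose b0 := b - wp p c0; have hb0 : as_defect v p b0 by apply: as_defect_translate.
have S0 : gap_values v p b0 = gap_values v p b by apply: gap_values_translate.
have p_gt0 : (0 < p)%N by rewrite prime_gt0 ?(pcharf_prime hp).
(* v c >= min (v t) (v e), because wp c is the difference of b0 and b0 - wp c,
   whose values are p v t and p v e; the choice of al gives p v e < v t *)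
have large c e : v e <i v 1 -> v (b0 - wp p c) = v (e ^+ p) -> v (e ^+ p) <i v c.
  move=> e1 ec; have [ga ega] := val_fin v (val_lt_neq0 e1).
  have et : v (e ^+ p) <i v t.
    rewrite (valX_Some p ega) tal inf_lt_Some -og_ltN opprK -mulNrn.
    by apply: al_min; rewrite -S0; exists c, e; split; rewrite ?opprK.
  have wc : wp p c = b0 - (b0 - wp p c) by rewrite subKr.
  case: (boolP (v t <=i v e)) => te.
    apply: inf_lt_le_trans et _; apply: (val_wp_le hp) => //.
    rewrite wc; apply: val_leB; first by rewrite /b0 tc inf_lexx.
    by rewrite ec val_leX.
  apply: inf_lt_le_trans (val_ltX_self _ e1) _.
    by rewrite prime_gt1 ?(pcharf_prime hp).
  apply: (val_wp_le hp) => //; rewrite wc; apply: val_leB; last by rewrite ec inf_lexx.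
  by rewrite /b0 tc val_leX // inf_ltW.
have t0 := val_lt_neq0 t1.
pose b_ n := (t ^+ n.+1) ^+ p * b0.
have tn0 n : t ^+ n.+1 != 0 by rewrite expf_neq0.
have tn1 n : v (t ^+ n.+1) <=i v 1 by rewrite -(expr1n _ n.+1) val_leX // inf_ltW.
have Sal0 : gap_values v p b0 al by rewrite S0.
have Sb n be : gap_values v p (b_ n) be <-> gap_values v p b0 (be - al *+ n.+1).
  rewrite -mulNrn; apply: gap_values_scale => //; exact: valX_Some.
exists b_; split.
- by move=> n; apply: as_defect_scale.
- exact: (family_not_above Sal0 Sb).
- exact: (family_distinct Sal0 Sb).
Qed.

(** The gap values of a root y1 are values of Sigma whether or not y1 generates
    the extension, and Sigma depends only on the extension: so isomorphic
    extensions have the same gap values. *)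
Lemma root_gap_values_sub (K : fieldType) (p : nat) (G : orderedGroupType)
    (v : valuation K G) (b1 b2 : K) (L : splittingFieldType K)
    (w : valuation L G) (y1 y2 : L) :
  p \in [pchar K] -> as_defect v p b1 -> as_defect v p b2 ->
  (forall a : K, w a%:A = v a) -> galois_defect w p ->
  wp p y1 = b1%:A -> wp p y2 = b2%:A -> <<1; y2>>%VS = fullv ->
  gap_values v p b1 `<=` gap_values v p b2.
Proof.
move=> hp hb1 hb2 hw [galL dimL _ _] hy1 hy2 gen.
have [s gs] := gal_generator hp galL dimL.
rewrite -(Sigma_eq hp hb2 hw galL gs hy2 dimL gen).
exact: (gap_values_Sigma hp hb1 hw galL gs hy1).
Qed.

Lemma lrmorph_wp (K : fieldType) (L1 L2 : fieldExtType K) (p : nat)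
    (f : {lrmorphism L1 -> L2}) (y : L1) : f (wp p y) = wp p (f y).
Proof. by rewrite /wp rmorphB rmorphXn. Qed.

Lemma lrmorph_scalar (K : fieldType) (L1 L2 : fieldExtType K)
    (f : {lrmorphism L1 -> L2}) (a : K) : f a%:A = a%:A.
Proof. by rewrite linearZ /= rmorph1. Qed.

Theorem theorem1p3 (K : fieldType) (G : orderedGroupType) (v : valuation K G)
    (p : nat) (hp : p \in [pchar K])
    (hK : exists E : valued_extension v, artin_schreier_dependent p E) :
  exists E : nat -> valued_extension v,
    (forall i, artin_schreier_dependent p (E i)) /\
    (forall i j, i <> j -> ~ K_isomorphic (ext_field (E i)) (ext_field (E j))).
Proof.
case: hK => [[L0 G0 w0 vw0]] [/= def0 dep0].
have [galL0 dimL0 _ _] := def0.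
have [s0 gs0] := gal_generator hp galL0 dimL0.
have [b [y [hy gen]]] := artin_schreier_generator hp galL0 dimL0 gs0.
have hb := galois_defect_as_defect hp def0 hy gen.
have nI : ~ gaps_above_subgroup p (val_restr w0) b.
  by move/(independent_defectP hp hb (fun=> erefl) def0 hy gen).
have [b_ [hb_ nI_ dist]] := dependent_defect_family hp hb nI.
have ext n : exists T : {L : splittingFieldType K & valuation L G0}, exists z : tag T,
    [/\ forall a : K, tagged T a%:A = val_restr w0 a, galois_defect (tagged T) p,
        wp p z = (b_ n)%:A & <<1; z>>%VS = fullv].
  have [L [w [z h]]] := artin_schreier_extension hp (hb_ n).
  by exists (existT _ L w), z.
have /choice[T hT] := ext.
have restr n : val_equiv v (val_restr (tagged (T n))).
  by have [z [hw _ _ _]] := hT n; move=> a c; rewrite vw0 /= !hw.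
exists (fun n => ValuedExtension (restr n)); split=> [n|m n mn [/= f bij_f]].
  have [z [hw defT hz genz]] := hT n; split=> //=.
  by apply: contra_not (nI_ n) => /(independent_defectP hp (hb_ n) hw defT hz genz).
have [zm [hwm defm hzm genm]] := hT m; have [zn [hwn defn hzn genn]] := hT n.
have [[be [S1 S2]]|[be [S1 S2]]] := dist m n mn.
  apply: S2; have fz : wp p (f zm) = (b_ m)%:A by rewrite -lrmorph_wp hzm lrmorph_scalar.
  exact: (root_gap_values_sub hp (hb_ m) (hb_ n) hwn defn fz hzn genn).
apply: S2; have [g fg gf] := bij_f.
have gz : wp p (g zn) = (b_ n)%:A.
  by apply: (can_inj fg); rewrite lrmorph_wp lrmorph_scalar gf.
exact: (root_gap_values_sub hp (hb_ n) (hb_ m) hwm defm gz hzm genm).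
Qed.
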